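(* Let $X=(X,\|\cdot\|_X)$ be a separable real Banach space that admits a separating polynomial, let $G\subset X$ be a bounded open set, and let $F:G\to\mathbb{R}$ be bounded and uniformly continuous. Then for each $\varepsilon>0$ there is a real analytic function $K:G\to\mathbb{R}$ which is Lipschitz on $G$ and such that $|F(x)-K(x)|<\varepsilon$ for all $x\in G$.
   Context: Let $X$ be a real Banach space with unit sphere $S_X=\{x\in X:\|x\|_X=1\}$. A homogeneous polynomial of degree $n$ (an $n$-homogeneous polynomial) on $X$ is a map $P:X\to\mathbb{R}$ of the form $P(x)=A(x,x,\dots,x)$, where $A:X^n\to\mathbb{R}$ is $n$-multilinear and continuous; for $n=0$, $P$ is constant. A polynomial of degree $n$ on $X$ is a sum $\sum_{i=0}^n P_i(x)$ with each $P_i$ an $i$-homogeneous polynomial. A separating polynomial on $X$ is a polynomial $q$ on $X$ such that $0=q(0)<\inf\{|q(x)|:x\in S_X\}$. For an open set $G\subset X$, a function $f:G\to\mathbb{R}$ is called (real) analytic if for every $x\in G$ there are a neighbourhood $N_x$ of $x$ and homogeneous polynomials $P_n^x:X\to\mathbb{R}$ of degree $n$ ($n\ge 0$) such that $f(x+h)=\sum_{n\ge0}P_n^x(h)$ whenever $x+h\in N_x$. *)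

(* Defs.v *)
From mathcomp Require Import all_boot all_order all_algebra.
From mathcomp Require Import all_classical all_reals all_analysis.

Set Implicit Arguments.
Unset Strict Implicit.
Unset Printing Implicit Defensive.

Import Order.TTheory GRing.Theory Num.Theory.
Import numFieldNormedType.Exports.

Local Open Scope classical_set_scope.
Local Open Scope ring_scope.

Definition separable_space (T : topologicalType) : Prop :=
  exists2 D : set T, countable D & dense D.

Definition unit_sphere (R : realType) (X : normedModType R) : set X :=
  [set x | `|x| = 1].

(* [@dfwith _ _ v i x] is the tuple [v] with its [i]-th entry replaced by [x]. *)
Definition multilinear_form (R : realType) (X : normedModType R) (n : nat)
    (A : ('I_n -> X) -> R) : Prop :=
  forall (i : 'I_n) (v : 'I_n -> X), scalar (fun x : X => A (@dfwith _ _ v i x)).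

(* For [n = 0] the domain of [A] is a single point, so [P] is any constant. *)
Definition homogeneous_polynomial (R : realType) (X : normedModType R) (n : nat)
    (P : X -> R) : Prop :=
  exists A : {ptws 'I_n -> X} -> R,
    [/\ multilinear_form A, continuous A & forall x, P x = A (fun=> x)].

Definition polynomial_of_degree (R : realType) (X : normedModType R) (n : nat)
    (q : X -> R) : Prop :=
  exists P : nat -> X -> R,
    (forall i, (i <= n)%N -> homogeneous_polynomial i (P i)) /\
    (forall x, q x = \sum_(i < n.+1) P i x).

(* The infimum is taken in the extended reals, so that it is [+oo] when the
   sphere is empty, i.e. when [X] is the zero space. *)
Definition separating_polynomial (R : realType) (X : normedModType R)
    (q : X -> R) : Prop :=
  [/\ exists n, polynomial_of_degree n q,
      q 0 = 0
    & (0 < ereal_inf [set `|q x|%:E | x in @unit_sphere R X])%E].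

(* A function on [G] is represented by a function on [X]; only its values on
   [G] matter, since the neighbourhood [N] is contained in [G]. *)
Definition real_analytic_on (R : realType) (X : normedModType R)
    (G : set X) (f : X -> R) : Prop :=
  forall x, G x -> exists N : set X, exists P : nat -> X -> R,
    [/\ nbhs x N, N `<=` G, forall n, homogeneous_polynomial n (P n)
      & forall h, N (x + h) ->
          series (fun n => P n h) @ \oo --> f (x + h)].

(* Main.v *)
Require Import Defs.
From mathcomp Require Import all_boot all_order all_algebra.
From mathcomp Require Import all_classical all_reals all_analysis.
From mathcomp Require Import ring lra zify.

Import Order.TTheory GRing.Theory Num.Theory.
Import numFieldNormedType.Exports.

Local Open Scope classical_set_scope.
Local Open Scope ring_scope.

(** The approximation is built from random experiments whose probabilities are
    polynomials in the point [x].

    _Sample points and trials._ Let [Q] be the sum of the squares of the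
    homogeneous parts of the separating polynomial: it vanishes at [0] and is
    bounded below away from [0], so [Q (x - p)] serves as a distance from [x]
    to [p]. Fix sample points [p_0, p_1, ...] of [G], each point of [G] being
    approximated with bounded gaps in the index (lemma [syndetic_sampling]),
    and colour them by the sign of [F]. Trial [j] at [x] should succeed when
    [x] is near [p_j] and fail when [x] is far from it; the failure
    probability [miss] is a binomial tail ([btail]) in [Q (x - p_j)] whose
    sharpness [2 ^ j] makes the total probability of false successes small. As
    [x] has near sample points, some trial succeeds, and the probability
    [first_hit] that the first success is positively coloured is close to [1]
    where [F] is large and close to [0] where [F] is very negative.

    _Lipschitz continuity._ This probability varies steeply with [x]. But it
    is monotone in each failure probability, in a direction given by the
    colour ([first_hit_anti]). Shift the distances by a threshold [t], upwards
    for one colour and downwards for the other: then moving [x] changes the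
    probability by no more than moving [t] does, and averaging over [t] in
    [[0, 1]] leaves a Lipschitz function ([average_lipschitz]).

    _Analyticity._ The averages over a finite grid of thresholds and finitely
    many trials are polynomials, and they are controlled in the norm
    [sum_k |A_k| r^k] of the expansion around [x]. This norm ([maj]) is
    submultiplicative, which makes it a substitute for bounds on a complex
    neighbourhood. In that norm a trial of sharpness [2 ^ j] costs at most
    [v ^ (2 ^ j)] with [v] close to [1] for small [r], while a trial at a near
    point gains [(3/4) ^ (2 ^ j)]; since the near points recur with bounded gaps
    they win, and the products of failure probabilities decay geometrically
    ([prod_gap_le], [maj_prod_miss]). The averages are therefore bounded in the
    norm uniformly in the number of trials, and by a Montel argument their limit
    along an ultrafilter is analytic ([maj_ultra_limit]).

    _Conclusion._ The limit separates the points where [F] is large from those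
    where [F] is very negative ([analytic_separation]), and Tietze's iteration
    ([tietze_iteration]) turns such functions into uniform approximations. *)

Set Implicit Arguments.
Unset Strict Implicit.
Unset Printing Implicit Defensive.

(** * Bounded multilinear forms *)

Section Forms.
Context {R : realType} {X : normedModType R}.
Implicit Types (A B : (nat -> X) -> R) (C D : R) (v w : nat -> X).

Definition setn v i x : nat -> X := fun j => if j == i then x else v j.

(** Forms of all degrees act on infinite sequences, of which they read the first
    [k] entries: products and insertions of arguments then need no casts. *)
Record mlform k A C : Prop := Mlform {
  mlform_ge0 : 0 <= C;
  mlform_ext : forall v w, (forall j, (j < k)%N -> v j = w j) -> A v = A w;
  mlform_lin : forall i v a x y, (i < k)%N ->
    A (setn v i (a *: x + y)) = a * A (setn v i x) + A (setn v i y);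
  mlform_bound : forall v, `|A v| <= C * \prod_(i < k) `|v i| }.

Lemma mlform_const c : mlform 0 (fun=> c) `|c|.
Proof. by split=> // v; rewrite big_ord0 mulr1. Qed.

Lemma mlform_le k A C D : C <= D -> mlform k A C -> mlform k A D.
Proof.
move=> CD [C0 Ae Al Ab]; split=> //; first exact: le_trans CD.
by move=> v; apply: le_trans (Ab v) _; rewrite ler_wpM2r ?prodr_ge0.
Qed.

Lemma mlform_add k A B C D : mlform k A C -> mlform k B D ->
  mlform k (fun v => A v + B v) (C + D).
Proof.
move=> [C0 Ae Al Ab] [D0 Be Bl Bb]; split; first exact: addr_ge0.
- by move=> v w vw; rewrite (Ae v w) ?(Be v w).
- by move=> i v a x y ik; rewrite Al ?Bl//; ring.
- by move=> v; rewrite mulrDl (le_trans (ler_normD _ _))// lerD.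
Qed.

Lemma mlform_mul k l A B C D : mlform k A C -> mlform l B D ->
  mlform (k + l) (fun v => A v * B (fun i => v (k + i)%N)) (C * D).
Proof.
move=> [C0 Ae Al Ab] [D0 Be Bl Bb]; split; first exact: mulr_ge0.
- move=> v w vw; rewrite (Ae v w) 1?(Be _ (fun i => w (k + i)%N))//.
    by move=> j jl; apply: vw; rewrite ltn_add2l.
  by move=> j jk; apply: vw; rewrite ltn_addr.
- move=> i v a x y ikl; case: (ltnP i k) => ik.
    rewrite Al //; set Bx := B _; set Bx' := B _; set Bx'' := B _.
    have E z : B (fun j => setn v i z (k + j)%N) = B (fun j => v (k + j)%N).
      by apply: Be => j _; rewrite /setn gtn_eqF// (leq_trans ik)// leq_addr.
    by rewrite /Bx /Bx' /Bx'' !E; ring.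
  have EA z : A (setn v i z) = A v.
    by apply: Ae => j jk; rewrite /setn ltn_eqF// (leq_trans jk).
  have EB z : (fun j => setn v i z (k + j)%N) =
              setn (fun j => v (k + j)%N) (i - k)%N z.
    apply: funext => j; rewrite /setn; congr (if _ then _ else _).
    by apply/eqP/eqP => ?; lia.
  by rewrite !EA !EB Bl ?ltn_subLR//; ring.
- move=> v; rewrite normrM big_split_ord/= mulrACA.
  by rewrite ler_pM.
Qed.

Definition insn i c v : nat -> X :=
  fun j => if (j < i)%N then v j else if j == i then c else v j.-1.

Lemma mlform_ins k A C i c : (i <= k)%N -> mlform k.+1 A C ->
  mlform k (fun v => A (insn i c v)) (C * `|c|).
Proof.
move=> ik [C0 Ae Al Ab]; split; first exact: mulr_ge0.
- move=> v w vw; apply: Ae => j jk; rewrite /insn.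
  case: ltngtP => // ij; apply: vw; lia.
- move=> l v a x y lk.
  have E z : insn i c (setn v l z) = setn (insn i c v) (if (l < i)%N then l else l.+1) z.
    apply: funext => j; rewrite /insn /setn.
    case: (ltngtP j i) => ji; case: (ltnP l i) => li;
      do ?[case: ifP => /eqP ?] => //; exfalso; lia.
  by rewrite !E Al//; case: ifP; lia.
- move=> v; apply: le_trans (Ab _) _; rewrite -mulrA ler_wpM2l//.
  have ik' : (i < k.+1)%N by [].
  rewrite (bigD1_ord (Ordinal ik'))//= {1}/insn ltnn eqxx.
  rewrite ler_wpM2l// le_eqVlt; apply/orP; left; apply/eqP.
  apply: eq_bigr => -[j jk] _ /=; rewrite /insn /bump.
  case: (leqP i j) => ij /=; last by rewrite add0n ij.
  by rewrite add1n ltnNge (leqW ij)/= gtn_eqF.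
Qed.

(** Needed for arbitrary filters: the coefficients of the approximations only
    converge along an ultrafilter. *)
Lemma mlform_lim (T : Type) (F : set_system T) {FF : ProperFilter F} k
    (A_ : T -> (nat -> X) -> R) A C :
  (forall n, mlform k (A_ n) C) -> (forall v, A_ n v @[n --> F] --> A v) ->
  mlform k A C.
Proof.
move=> Af AA; have /filter_ex [n0 _] : F setT by exact: filterT.
have uniq (u : T -> R) (a b : R) : u n @[n --> F] --> a -> u n @[n --> F] --> b -> a = b.
  by move=> ua ub; exact: (norm_cvg_unique ua ub).
split; first by case: (Af n0).
- move=> v w vw; apply: (uniq (A_ ^~ v)) => //.
  suff -> : A_ ^~ v = A_ ^~ w by [].
  by apply: funext => n; exact: (mlform_ext (Af n)).
- move=> i v a x y ik; apply: (uniq (A_ ^~ (setn v i (a *: x + y)))) => //.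
  under eq_fun do rewrite (mlform_lin (Af _))//.
  exact: (cvgD (cvgM (cvg_cst a) (AA _)) (AA _)).
- move=> v; apply: (closed_cvg _ (@closed_le R _) _ _ (cvg_norm (AA v))).
  by apply: nearW => n; exact: (mlform_bound (Af n)).
Qed.

Lemma multilinear_scale k A :
  (forall v w, (forall j, (j < k)%N -> v j = w j) -> A v = A w) ->
  (forall i v a x y, (i < k)%N ->
    A (setn v i (a *: x + y)) = a * A (setn v i x) + A (setn v i y)) ->
  forall (s : nat -> R) v,
  A (fun i => s i *: v i) = (\prod_(i < k) s i) * A v.
Proof.
move=> Ae Al s v.
have E m : (m <= k)%N ->
    A (fun i => if (i < m)%N then s i *: v i else v i) = (\prod_(i < m) s i) * A v.
  elim: m => [_|m IH mk]; first by rewrite big_ord0 mul1r.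
  rewrite big_ord_recr/= mulrAC -IH 1?ltnW//.
  set u := fun i => if (i < m)%N then s i *: v i else v i.
  have -> : (fun i => if (i < m.+1)%N then s i *: v i else v i) =
            setn u m (s m *: v m + 0).
    apply: funext => i; rewrite /setn /u addr0 ltnS.
    by case: ltngtP => // ->.
  have Z : A (setn u m 0) = 0.
    have := Al m u 1 0 0 mk; rewrite scale1r add0r mul1r; lra.
  rewrite Al// Z addr0 mulrC; congr (_ * _); congr A.
  by apply: funext => i; rewrite /setn /u; case: eqP => // ->; rewrite ltnn.
by rewrite -E//; apply: Ae => j jk; rewrite jk.
Qed.

(** Continuity at [0] bounds the form on a box; rescaling the arguments one by
    one turns this into a bound by the product of their norms. *)
Lemma homogeneous_mlform k (P : X -> R) : homogeneous_polynomial k P ->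
  exists A C, mlform k A C /\ forall x, P x = A (fun=> x).
Proof.
move=> [A0 [A0l A0c PA]].
pose A v := A0 (fun i : 'I_k => v i).
have Ae v w : (forall j, (j < k)%N -> v j = w j) -> A v = A w.
  by move=> vw; rewrite /A; congr A0; apply: funext => i; exact: vw.
have Al i v a x y : (i < k)%N ->
    A (setn v i (a *: x + y)) = a * A (setn v i x) + A (setn v i y).
  move=> ik; have E z : (fun j : 'I_k => setn v i z j) =
      dfwith (fun j : 'I_k => v j) (Ordinal ik) z.
    apply: funext => j; have [ji|ji] := eqVneq (Ordinal ik) j.
      by rewrite -ji dfwithin /setn eqxx.
    rewrite dfwithout//; rewrite /setn; case: eqP => // e.
    by case/eqP: ji; apply: val_inj.
  by rewrite /A !E A0l.
pose F : set_system {ptws 'I_k -> X} :=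
  filter_from [set e : R | 0 < e] (fun e => [set v | forall i, `|v i| <= e]).
have FF : Filter F.
  apply: filter_from_filter; first by exists 1 => /=.
  move=> a b /= a0 b0; exists (Num.min a b); first by rewrite /= lt_min a0.
  by move=> v /= vab; split => i /=; apply: le_trans (vab i) _; rewrite ge_min lexx ?orbT.
pose z0 : {ptws 'I_k -> X} := fun=> 0.
have F0 : F --> z0.
  apply/cvg_sup => i; apply/cvg_image.
    by apply/seteqP; split=> // x _; exists (fun=> x).
  move=> U /nbhs_ballP [e /= e0 eU].
  exists [set v | U (v i)]; last first.
    apply/seteqP; split=> [x [v Uv <-]//|x Ux]; exists (fun=> x) => //.
  exists (e / 2); first by rewrite /= divr_gt0.
  move=> v /= vi; apply: eU; rewrite -ball_normE/= sub0r normrN.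
  by rewrite (le_lt_trans (vi i))// ltr_pdivrMr// ltr_pMr// ltr1n.
have := A0c z0; rewrite /continuous_at => A0c0.
have /cvgrPdist_le/(_ 1 ltr01) [e /= e0 eA] : A0 v @[v --> F] --> A0 z0.
  by apply: cvg_trans A0c0; exact: cvg_app.
pose K := 1 + `|A0 z0|.
have K0 : 0 <= K by rewrite addr_ge0.
exists A, (K * e^-1 ^+ k); split; last by move=> x; rewrite PA.
split=> //; first by rewrite mulr_ge0// exprn_ge0// invr_ge0 ltW.
move=> v; have [/existsP [i /eqP vi]|] := boolP [exists i : 'I_k, v i == 0].
  rewrite (_ : A v = 0) ?normr0.
    by rewrite !mulr_ge0 ?prodr_ge0// exprn_ge0// invr_ge0 ltW.
  pose s (j : nat) : R := (j != i)%:R.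
  rewrite (_ : v = fun j => s j *: v j).
    by rewrite (multilinear_scale Ae Al) (bigD1 i)//= /s eqxx !mul0r.
  apply: funext => j; rewrite /s; case: eqP => [->|_]; last by rewrite scale1r.
  by rewrite scale0r.
rewrite negb_exists => /forallP v0.
pose u j := (e / `|v j|) *: v j.
rewrite (Ae v (fun j => (e^-1 * `|v j|) *: u j)); last first.
  move=> j jk; rewrite scalerA [X in X *: _](_ : _ = 1) ?scale1r//.
  have := v0 (Ordinal jk) => /= vj0; field.
  by rewrite normr_eq0 vj0 gt_eqF.
rewrite (multilinear_scale Ae Al) normrM big_split/= prodr_const card_ord.
rewrite ger0_norm; last first.
  by rewrite mulr_ge0 ?prodr_ge0 ?exprn_ge0 ?invr_ge0 ?(ltW e0).
rewrite -[leRHS]mulrA [leRHS]mulrC ler_wpM2l//.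
  by rewrite mulr_ge0 ?prodr_ge0 ?exprn_ge0 ?invr_ge0 ?(ltW e0).
have : `|A0 z0 - A u| <= 1.
  apply: eA => i /=; rewrite normrZ normrM normfV normr_id divfK ?normr_eq0//.
  by rewrite gtr0_norm.
rewrite /K distrC => h; rewrite -(subrK (A0 z0) (A u)).
by rewrite (le_trans (ler_normD _ _))// lerD.
Qed.

(** The entries are moved from [w] to [v t] one at a time; each move changes the
    value by a form with one small argument and the others bounded. *)
Lemma mlform_cvg (T : Type) (F : set_system T) {FF : Filter F} k A C
    (v : T -> nat -> X) (w : nat -> X) : mlform k A C ->
  (forall j, (j < k)%N -> v t j @[t --> F] --> w j) ->
  A (v t) @[t --> F] --> A w.
Proof.
move=> [C0 Ae Al Ab] vw.
pose u m t i := if (i < m)%N then v t i else w i.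
suff G m : (m <= k)%N -> A (u m t) @[t --> F] --> A w.
  rewrite (_ : (fun t => A (v t)) = (fun t => A (u k t))); first exact: G.
  by apply: funext => t; apply: Ae => j jk; rewrite /u jk.
elim: m => [_|m IH mk]; first exact: cvg_cst.
have -> : (fun t => A (u m.+1 t)) =
    (fun t => A (u m t) + A (setn (u m t) m (v t m - w m))).
  apply: funext => t.
  have -> : u m.+1 t = setn (u m t) m (1 *: (v t m - w m) + w m).
    apply: funext => i; rewrite /setn /u scale1r subrK ltnS.
    by case: ltngtP => // ->.
  rewrite Al// mul1r addrC; congr (A _ + _).
  by apply: funext => i; rewrite /setn /u; case: eqP => // ->; rewrite ltnn.
rewrite -[A w]addr0; apply: cvgD; first by apply: IH; exact: ltnW.
apply/norm_cvg0P; apply: (@squeeze_cvgr _ _ _ _ (fun=> 0)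
  (fun t => C * \prod_(i < k) `|setn (u m t) m (v t m - w m) i|)) => //.
+ by apply: nearW => t /=; rewrite normr_ge0 Ab.
+ exact: cvg_cst.
rewrite [X in _ --> X](_ : 0 = C * \prod_(i < k) `|setn w m 0 i|).
  apply: cvgM; first exact: cvg_cst.
  apply: cvg_big => [|i _]; first exact: mul_continuous.
  have ik := ltn_ord i; apply: cvg_norm; rewrite /setn; case: eqP => [_|_].
    by rewrite -(subrr (w m)); apply: cvgB; [exact: vw|exact: cvg_cst].
  by rewrite /u; case: (i < m)%N; [exact: vw|exact: cvg_cst].
by rewrite (bigD1 (Ordinal mk))//= /setn eqxx normr0 mul0r mulr0.
Qed.

Lemma mlform_homogeneous k A C : mlform k A C ->
  homogeneous_polynomial k (fun x => A (fun=> x)).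
Proof.
move=> Af.
pose ext (w : 'I_k -> X) (j : nat) : X := oapp w 0 (insub j).
have extlt (w : 'I_k -> X) j (jk : (j < k)%N) : ext w j = w (Ordinal jk).
  by rewrite /ext insubT.
exists (fun w : {ptws 'I_k -> X} => A (ext w)); split.
- move=> i v a x y.
  have E z : A (ext (dfwith v i z)) = A (setn (ext v) i z).
    apply: (mlform_ext Af) => j jk; rewrite !extlt /setn; case: eqP => [e|e].
      rewrite (_ : Ordinal jk = i) ?dfwithin//; exact: val_inj.
    by rewrite dfwithout ?extlt//; apply/eqP => e'; apply: e; rewrite e'.
  by rewrite !E (mlform_lin Af).
- move=> w; have FF : Filter (nbhs w) by exact: nbhs_filter.
  apply: (@mlform_cvg {ptws 'I_k -> X} (nbhs w) FF k A C ext (ext w) Af) => j jk.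
  rewrite extlt.
  have := @proj_continuous _ (fun=> X) (Ordinal jk) w.
  apply: cvg_trans; apply: near_eq_cvg; apply: nearW => v.
  by rewrite extlt.
- by move=> x; apply: (mlform_ext Af) => j jk; rewrite extlt.
Qed.

End Forms.

(** * Majorised polynomials *)

Section Majorants.
Context {R : realType} {X : normedModType R}.
Implicit Types (f g : X -> R) (r M N : R).

(** [maj r M f] bounds by [M] the norm [sum_k |A_k| r^k] of some expansion of the
    polynomial [f] into bounded forms. Generating these polynomials inductively
    makes the norm estimate for products a double induction instead of a
    Cauchy product. *)
Inductive maj r : R -> (X -> R) -> Prop :=
| MajMlform k A C : mlform k A C -> maj r (C * r ^+ k) (fun h => A (fun=> h))
| MajAdd M N f g : maj r M f -> maj r N g -> maj r (M + N) (fun h => f h + g h)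
| MajLe M N f g : maj r M f -> M <= N -> f =1 g -> maj r N g.

Lemma maj_ge0 r M f : 0 <= r -> maj r M f -> 0 <= M.
Proof.
move=> r0; elim=> {M f} [k A C [C0 _ _ _]|M N f g _ M0 _ N0|M N f g _ M0 MN _].
- by rewrite mulr_ge0 ?exprn_ge0.
- exact: addr_ge0.
- exact: le_trans MN.
Qed.

Lemma maj_bound r M f h : `|h| <= r -> maj r M f -> `|f h| <= M.
Proof.
move=> hr; elim=> {M f} [k A C Af|M N f g _ fM _ gN|M N f g _ fM MN <-].
- apply: le_trans (mlform_bound Af _) _; rewrite prodr_const card_ord.
  by rewrite ler_wpM2l ?(mlform_ge0 Af)// lerXn2r// nnegrE// (le_trans _ hr).
- by rewrite (le_trans (ler_normD _ _))// lerD.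
- exact: le_trans MN.
Qed.

Lemma maj_cst r c : maj r `|c| (fun=> c).
Proof. by have := MajMlform r (mlform_const c); rewrite expr0 mulr1. Qed.

Lemma maj_mul r M N f g : 0 <= r -> maj r M f -> maj r N g ->
  maj r (M * N) (fun h => f h * g h).
Proof.
move=> r0 Mf Ng; elim: Mf => {M f}
  [k A C Af|M M' f f' _ IH _ IH'|M M' f f' _ IH MM' ff'].
- elim: Ng => {N g} [l B D Bf|N N' g g' _ IH _ IH'|N N' g g' _ IH NN' gg'].
  + apply: MajLe (MajMlform r (mlform_mul Af Bf)) _ _ => //.
    by rewrite exprD mulrACA.
  + by apply: MajLe (MajAdd IH IH') _ _ => [|h]; rewrite mulrDr.
  + apply: MajLe IH _ _ => [|h]; last by rewrite gg'.
    by rewrite ler_wpM2l// mulr_ge0 ?(mlform_ge0 Af) ?exprn_ge0.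
- by apply: MajLe (MajAdd IH IH') _ _ => [|h]; rewrite mulrDl.
- apply: MajLe IH _ _ => [|h]; last by rewrite ff'.
  by rewrite ler_wpM2r// (maj_ge0 r0 Ng).
Qed.

Lemma maj_scale r M f a : 0 <= r -> maj r M f -> maj r (`|a| * M) (fun h => a * f h).
Proof. by move=> r0; apply: maj_mul => //; exact: maj_cst. Qed.

Lemma maj_sub r M N f g : 0 <= r -> maj r M f -> maj r N g ->
  maj r (M + N) (fun h => f h - g h).
Proof.
move=> r0 Mf Ng; apply: MajLe (MajAdd Mf (maj_scale (-1) r0 Ng)) _ _ => [|h].
  by rewrite normrN1 mul1r.
by rewrite mulN1r.
Qed.

Lemma maj_sum r (I : Type) (s : seq I) (P : pred I) (M : I -> R) (f : I -> X -> R) :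
  (forall i, P i -> maj r (M i) (f i)) ->
  maj r (\sum_(i <- s | P i) M i) (fun h => \sum_(i <- s | P i) f i h).
Proof.
move=> Mf; elim: s => [|i s IH].
  rewrite big_nil; apply: MajLe (maj_cst r 0) _ _; first by rewrite normr0.
  by move=> h; rewrite big_nil.
rewrite big_cons; case: ifPn => Pi; last first.
  by apply: MajLe IH _ _ => // h; rewrite big_cons (negbTE Pi).
by apply: MajLe (MajAdd (Mf i Pi) IH) _ _ => // h; rewrite big_cons Pi.
Qed.

Lemma maj_expansion r M f : 0 <= r -> maj r M f ->
  exists A : nat -> (nat -> X) -> R, exists (a : nat -> R) (d : nat),
  [/\ forall k, mlform k (A k) (a k),
      forall D h, (d <= D)%N -> f h = \sum_(0 <= k < D) A k (fun=> h)
    & forall D, \sum_(0 <= k < D) a k * r ^+ k <= M].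
Proof.
move=> r0; elim=> {M f} [k A C Af|M N f g _ [A [a [d [Af fE aM]]]]
    _ [B [b [e [Bf gE bM]]]]|M N f g _ [A [a [d [Af fE aM]]]] MN fg].
- exists (fun j => if j == k then A else fun=> 0), (fun j => if j == k then C else 0), k.+1.
  split.
  + move=> j; case: eqP => [->//|_].
    by split=> // *; rewrite ?mulr0 ?addr0 ?mul0r ?normr0.
  + move=> D h kD; rewrite (big_cat_nat _ (n := k.+1))//= big_nat_recr//= eqxx.
    by rewrite !big_nat !big1 ?add0r ?addr0// => i /andP[? ?]; case: eqP => //; lia.
  + move=> D; have [kD|Dk] := ltnP k D.
      rewrite (big_cat_nat _ (n := k.+1))//= big_nat_recr//= eqxx.
      rewrite !big_nat !big1 ?add0r ?addr0// => i /andP[? ?]; case: eqP; rewrite ?mul0r//; lia.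
    rewrite big_nat big1 ?mulr_ge0 ?exprn_ge0 ?(mlform_ge0 Af)// => i /andP[_ iD].
    by rewrite ltn_eqF ?mul0r// (leq_trans iD).
- exists (fun k v => A k v + B k v), (fun k => a k + b k), (maxn d e); split.
  + by move=> k; exact: mlform_add.
  + move=> D h; rewrite geq_max => /andP[dD eD].
    by rewrite big_split/= -(fE D)// -(gE D).
  + move=> D; under eq_bigr do rewrite mulrDl.
    by rewrite big_split/= lerD.
- exists A, a, d; split=> //; first by move=> D h dD; rewrite -fg (fE D).
  by move=> D; exact: le_trans MN.
Qed.

End Majorants.

(** * Limits of majorised polynomials *)

Section UltraLimits.
Context {R : realType}.

Lemma ultra_bounded_cvg (T : Type) (U : set_system T) (UU : UltraFilter U)
    (u : T -> R) M : (forall n, `|u n| <= M) -> cvg (u @ U).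
Proof.
move=> uM.
have UI : UltraFilter (u @ U).
  split; first exact: fmap_proper_filter.
  move=> G GP uG; apply/seteqP; split=> [A GA|]; last exact: uG.
  have [//|nUA] := in_ultra_setVsetC (u @^-1` A) UU.
  have nA : G (~` A) by exact: uG.
  by have [x []] := filter_ex (filterI GA nA).
have : compact `[- M, M] by exact: segment_compact.
rewrite compact_ultra => /(_ _ UI) [|l [_ ul]].
  by apply: nearW => n /=; rewrite in_itv/= -ler_norml.
by apply/cvg_ex; exists l.
Qed.

Lemma filter_lim_le (T : Type) (F : set_system T) {FF : ProperFilter F}
    (f g : T -> R) (a b : R) : f n @[n --> F] --> a -> g n @[n --> F] --> b ->
  (forall n, f n <= g n) -> a <= b.
Proof.
move=> fa gb fg; rewrite -subr_ge0.
have := closed_cvg _ (@closed_ge R 0) _ _ (cvgB gb fa); apply.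
by apply: nearW => n; rewrite /= subr_ge0.
Qed.

End UltraLimits.

Section Analytic.
Context {R : realType} {X : normedModType R}.

(** A local form of [real_analytic_on] in which sums can be taken term by term,
    the coefficients being bounded forms. *)
Definition power_series_at (x : X) (f : X -> R) :=
  exists (r : R) (A : nat -> (nat -> X) -> R) (a : nat -> R),
  [/\ 0 < r, forall k, mlform k (A k) (a k)
    & forall h, `|h| < r -> series (fun k => A k (fun=> h)) @ \oo --> f (x + h)].

Lemma power_series_cst x c : power_series_at x (fun=> c).
Proof.
exists 1, (fun k => if k is 0 then fun=> c else fun=> 0),
  (fun k => if k is 0 then `|c| else 0); split=> //.
  move=> [|k]; first exact: mlform_const.
  by split=> // *; rewrite ?mulr0 ?addr0 ?mul0r ?normr0.
move=> h _; rewrite -(cvg_shiftn 1)/=.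
rewrite (_ : (fun n => _) = fun=> c); first exact: cvg_cst.
apply: funext => n; rewrite /series/= addn1 big_nat_recl//= big1 ?addr0//.
Qed.

Lemma power_series_lin x f g b :
  power_series_at x f -> power_series_at x g ->
  power_series_at x (fun y => f y + b * g y).
Proof.
move=> [r [A [a [r0 Af fA]]]] [s [B [c [s0 Bf gB]]]].
exists (Num.min r s), (fun k v => A k v + b * B k v), (fun k => a k + `|b| * c k).
split; first by rewrite lt_min r0.
  by move=> k; apply: mlform_add => //; exact: (mlform_mul (mlform_const b) (Bf k)).
move=> h; rewrite lt_min => /andP[hr hs].
rewrite (_ : series _ = fun n => series (fun k => A k (fun=> h)) n +
    b * series (fun k => B k (fun=> h)) n); last first.
  by apply: funext => n; rewrite /series/= big_split/= mulr_sumr.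
by apply: cvgD; [exact: fA|apply: cvgM; [exact: cvg_cst|exact: gB]].
Qed.

Lemma power_series_analytic (G : set X) f : open G ->
  (forall x, G x -> power_series_at x f) -> real_analytic_on G f.
Proof.
move=> Go Gf x Gx; have [r [A [a [r0 Af fA]]]] := Gf x Gx.
exists (ball x r `&` G), (fun k h => A k (fun=> h)); split.
- by apply: filterI; [exact: nbhsx_ballx|exact: open_nbhs_nbhs].
- by move=> y [].
- by move=> k; exact: (mlform_homogeneous (Af k)).
- move=> h [+ _]; rewrite -ball_normE/= opprD addrA subrr sub0r normrN.
  exact: fA.
Qed.

(** Montel's theorem: the coefficients of uniformly majorised polynomials are
    bounded, so they too converge along the ultrafilter, and on the ball of
    half the radius the tails of the expansions are uniformly geometric. *)
Lemma maj_ultra_limit (T : Type) (U : set_system T) (UU : UltraFilter U)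
    (x : X) (f : T -> X -> R) (r M : R) : 0 < r ->
  (forall n, maj r M (fun h => f n (x + h))) ->
  power_series_at x (fun y => lim (f n y @[n --> U])).
Proof.
move=> r0 fM.
have /choice [A_ /choice [a_ /choice [d_ E]]] :=
  fun n => maj_expansion (ltW r0) (fM n).
have a0 n k : 0 <= a_ n k by have [Af _ _] := E n; exact: (mlform_ge0 (Af k)).
have ar n k : a_ n k * r ^+ k <= M.
  have [_ _ aM] := E n; apply: le_trans (aM k.+1).
  rewrite big_nat_recr//= lerDr sumr_ge0// => i _.
  by rewrite mulr_ge0// exprn_ge0// ltW.
have Af n k : mlform k (A_ n k) (M / r ^+ k).
  have [Af _ _] := E n; apply: mlform_le (Af k).
  by rewrite ler_pdivlMr ?exprn_gt0.
pose A k v := lim (A_ n k v @[n --> U]).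
have AA k v : A_ n k v @[n --> U] --> A k v.
  apply: (ultra_bounded_cvg UU) => n; exact: (mlform_bound (Af n k)).
exists (r / 2), A, (fun k => M / r ^+ k); split; first by rewrite divr_gt0.
  by move=> k; exact: (mlform_lim (fun n => Af n k) (AA k)).
move=> h hr2.
have hr : `|h| <= r by lra.
set l := lim _.
have fl : f n (x + h) @[n --> U] --> l.
  by apply: (ultra_bounded_cvg UU) => n; exact: (maj_bound hr (fM n)).
pose S n K := \sum_(0 <= k < K) A_ n k (fun=> h).
have Sl K : S n K @[n --> U] --> series (fun k => A k (fun=> h)) K.
  apply: cvg_big => [|k _]; [exact: add_continuous|exact: AA].
have tail n K : `|f n (x + h) - S n K| <= M * (2^-1) ^+ K.
  have [Afn fE aM] := E n.
  rewrite (fE (maxn (d_ n) K) h) ?leq_maxl// /S.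
  rewrite (big_cat_nat _ (n := K)) ?leq_maxr//= addrAC subrr add0r.
  apply: le_trans (ler_norm_sum _ _ _) _.
  apply: (@le_trans _ _ (\sum_(K <= k < maxn (d_ n) K) a_ n k * r ^+ k * 2^-1 ^+ K)).
    rewrite !big_nat ler_sum// => k /andP[Kk _].
    apply: le_trans (mlform_bound (Afn k) _) _.
    rewrite prodr_const card_ord -mulrA ler_wpM2l//.
    apply: (@le_trans _ _ ((r / 2) ^+ k)).
      by rewrite lerXn2r ?nnegrE ?divr_ge0// ltW.
    rewrite exprMn ler_wpM2l ?exprn_ge0 ?(ltW r0)//.
    by rewrite ler_wiXn2l//; lra.
  rewrite -mulr_suml ler_wpM2r ?exprn_ge0//.
  apply: le_trans (aM (maxn (d_ n) K)).
  rewrite [leRHS](big_cat_nat _ (n := K)) ?leq_maxr//= lerDr sumr_ge0// => k _.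
  by rewrite mulr_ge0// exprn_ge0// ltW.
have ltail K : `|l - series (fun k => A k (fun=> h)) K| <= M * (2^-1) ^+ K.
  apply: (closed_cvg _ (@closed_le R _) _ _ (cvg_norm (cvgB fl (Sl K)))).
  by apply: nearW => n; exact: tail.
apply/cvgrPdist_le => e e0.
have : geometric M 2^-1 @ \oo --> (0 : R).
  by apply: cvg_geometric; rewrite ger0_norm//; lra.
move=> /cvgr0_norm_le /(_ _ e0); apply: filterS => K.
move=> KM; apply: le_trans (ltail K) _; apply: le_trans KM.
exact: ler_norm.
Qed.

End Analytic.

(** * Polynomials under translation *)

Section Tame.
Context {R : realType} {X : normedModType R}.
Implicit Types (f g : X -> R) (A : (nat -> X) -> R) (r M N C D : R).

(** Uniformity in the centre [c] lets one radius serve all sample points; the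
    linear dependence on [r] also yields Lipschitz bounds. *)
Definition tame f := forall D, 0 <= D -> exists2 L, 0 <= L &
  forall c, `|c| <= D -> `|f c| <= L /\
    forall r, 0 <= r <= 1 -> maj r (L * r) (fun h => f (c + h) - f c).

(** Expanding the remaining [c + h] one at a time, each turns into an [h], which
    brings a factor [r], or into a [c], which lowers the degree. *)
Lemma mixed_maj p i A C c D r : mlform (i + p) A C -> `|c| <= D -> 0 <= r ->
  maj r (C * r ^+ i * (D + r) ^+ p)
    (fun h => A (fun j => if (j < i)%N then h else c + h)).
Proof.
move=> + cD r0; elim: p i A C => [|p IH] i A C Af.
  rewrite addn0 in Af; apply: MajLe (MajMlform r Af) _ _.
    by rewrite expr0 mulr1.
  by move=> h; apply: (mlform_ext Af) => j ->.
have D0 : 0 <= D := le_trans (normr_ge0 c) cD.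
have Ah : maj r (C * r ^+ i.+1 * (D + r) ^+ p)
    (fun h => A (fun j => if (j < i.+1)%N then h else c + h)).
  by apply: IH; rewrite addSnnS.
have Ac : maj r (C * `|c| * r ^+ i * (D + r) ^+ p)
    (fun h => A (insn i c (fun j => if (j < i)%N then h else c + h))).
  apply: (IH i (fun v => A (insn i c v))); apply: mlform_ins; first exact: leq_addr.
  by rewrite -addnS.
apply: MajLe (MajAdd Ah Ac) _ _.
  rewrite (exprS (D + r)) exprS -subr_ge0.
  rewrite [leRHS](_ : _ = C * r ^+ i * (D + r) ^+ p * (D - `|c|)); last by ring.
  by rewrite !mulr_ge0 ?exprn_ge0 ?subr_ge0 ?addr_ge0 ?(mlform_ge0 Af).
move=> h; set v := fun j => if (j < i)%N then h else c + h.
have -> : A v = A (setn v i (1 *: h + c)).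
  congr A; apply: funext => j; rewrite /setn /v scale1r addrC.
  by case: eqP => // ->; rewrite ltnn.
rewrite (mlform_lin Af) ?mul1r -?addSnnS ?leq_addr//; congr (A _ + A _).
  by apply: funext => j; rewrite /setn /v ltnS; case: ltngtP.
apply: funext => j; rewrite /setn /insn /v.
case: ltngtP => // ij; case: ifP => //; lia.
Qed.

(** Expanding only the first argument: the part in [h] is a mixed term, and the
    part in [c] is an increment of a form of lower degree. *)
Lemma mlform_increment_maj k A C c D r : mlform k A C -> `|c| <= D ->
  0 <= r <= 1 ->
  maj r (k%:R * C * (D + 1) ^+ k * r) (fun h => A (fun=> c + h) - A (fun=> c)).
Proof.
move=> + cD /andP[r0 r1]; elim: k A C => [|k IH] A C Af.
  rewrite !mul0r; apply: MajLe (maj_cst r 0) _ _; rewrite ?normr0// => h.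
  by apply/esym/eqP; rewrite subr_eq0; apply/eqP/(mlform_ext Af).
have D0 : 0 <= D := le_trans (normr_ge0 c) cD.
have Ah : maj r (C * r ^+ 1 * (D + r) ^+ k)
  (fun h => A (fun j => if (j < 1)%N then h else c + h)) by exact: mixed_maj.
have Ac := IH _ _ (mlform_ins (i := 0) c (leq0n k) Af).
apply: MajLe (MajAdd Ah Ac) _ _.
  have C0 := mlform_ge0 Af.
  have e1 : (D + r) ^+ k <= (D + 1) ^+ k by rewrite lerXn2r ?nnegrE ?addr_ge0// lerD2l.
  have e0 : 0 <= (D + r) ^+ k by rewrite exprn_ge0 ?addr_ge0.
  apply: (@le_trans _ _ (C * r * (D + 1) ^+ k * (D + 1) +
      k%:R * C * r * (D + 1) ^+ k * (D + 1))).
    apply: lerD.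
      rewrite expr1 -[leRHS]mulrA ler_wpM2l ?mulr_ge0//.
      by apply: (le_trans e1); rewrite ler_peMr ?(le_trans e0 e1)// lerDr.
    rewrite [leLHS](_ : _ = k%:R * C * r * (D + 1) ^+ k * `|c|); last by ring.
    rewrite ler_wpM2l ?mulr_ge0 ?(le_trans e0 e1)//.
    by rewrite (le_trans cD)// lerDl.
  by rewrite le_eqVlt; apply/orP; left; apply/eqP; rewrite exprS -natr1; ring.
move=> h.
have := mlform_lin Af (fun=> c + h) 1 h c (ltn0Sn k).
rewrite mul1r scale1r.
rewrite (_ : setn _ 0 (h + c) = fun=> c + h); last first.
  by apply: funext => j; rewrite /setn addrC; case: eqP.
move=> ->; rewrite addrA -!addrA; congr (A _ + (A _ - A _)).
- by apply: funext => -[|j].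
- by apply: funext => -[|j].
Qed.

Lemma mlform_tame k A C : mlform k A C -> tame (fun x => A (fun=> x)).
Proof.
move=> Af D D0; have C0 := mlform_ge0 Af.
have a0 : 0 <= C * D ^+ k by rewrite mulr_ge0 ?exprn_ge0.
have b0 : 0 <= k%:R * C * (D + 1) ^+ k.
  by rewrite !mulr_ge0 ?exprn_ge0 ?addr_ge0.
exists (C * D ^+ k + k%:R * C * (D + 1) ^+ k); first exact: addr_ge0.
move=> c cD; split.
  apply: le_trans (mlform_bound Af _) _; rewrite prodr_const card_ord.
  by apply: ler_wpDr => //; rewrite ler_wpM2l// lerXn2r ?nnegrE.
move=> r r01; apply: MajLe (mlform_increment_maj Af cD r01) _ _ => //.
by case/andP: r01 => r0 _; rewrite ler_wpM2r// lerDr.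
Qed.

Lemma tame_cst a : tame (fun=> a).
Proof. exact: (mlform_tame (mlform_const a)). Qed.

Lemma tame_add f g : tame f -> tame g -> tame (fun x => f x + g x).
Proof.
move=> ft gt D D0; have [L L0 fL] := ft D D0; have [K K0 gK] := gt D D0.
exists (L + K) => [|c cD]; first exact: addr_ge0.
have [fc fr] := fL c cD; have [gc gr] := gK c cD; split.
  by rewrite (le_trans (ler_normD _ _))// lerD.
move=> r r01; apply: MajLe (MajAdd (fr r r01) (gr r r01)) _ _ => [|h].
  by rewrite mulrDl.
by ring.
Qed.

Lemma tame_mul f g : tame f -> tame g -> tame (fun x => f x * g x).
Proof.
move=> ft gt D D0; have [L L0 fL] := ft D D0; have [K K0 gK] := gt D D0.
have LK : 0 <= L * K by exact: mulr_ge0.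
exists (3 * L * K) => [|c cD]; first by lra.
have [fc fr] := fL c cD; have [gc gr] := gK c cD; split.
  by rewrite normrM (le_trans (ler_pM _ _ fc gc))//; lra.
move=> r r01; have /andP[r0 r1] := r01.
apply: MajLe (MajAdd (maj_mul r0 (fr r r01) (gr r r01))
  (MajAdd (maj_scale (f c) r0 (gr r r01)) (maj_scale (g c) r0 (fr r r01)))) _ _ => [|h].
  have : `|f c| * (K * r) <= L * K * r by rewrite mulrA ler_wpM2r// ler_wpM2r.
  have : `|g c| * (L * r) <= L * K * r.
    by rewrite mulrA ler_wpM2r// (mulrC L) ler_wpM2r.
  have : L * r * (K * r) <= L * K * r.
    rewrite mulrACA ler_wpM2l// ler_piMr//.
  lra.
by ring.
Qed.

Lemma tame_sum n (f : nat -> X -> R) : (forall i, (i < n)%N -> tame (f i)) ->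
  tame (fun x => \sum_(i < n) f i x).
Proof.
elim: n => [|n IH] ft.
  rewrite (_ : (fun x => _) = fun=> 0); first exact: tame_cst.
  by apply: funext => x; rewrite big_ord0.
rewrite (_ : (fun x => _) = fun x => \sum_(i < n) f i x + f n x); last first.
  by apply: funext => x; rewrite big_ord_recr.
by apply: tame_add; [apply: IH => i /ltnW; exact: ft|exact: ft].
Qed.

Lemma tame_lipschitz f D : tame f -> 0 <= D -> exists2 L, 0 <= L &
  forall c d, `|c| <= D -> `|d| <= D -> `|f d - f c| <= L * `|d - c|.
Proof.
move=> ft D0; have [L L0 fL] := ft D D0.
exists (2 * L) => [|c d cD dD]; first by lra.
have [fc fr] := fL c cD; have [fd _] := fL d dD.
have [dc1|dc1] := leP `|d - c| 1.
  have /(maj_bound (lexx _)) : maj `|d - c| (L * `|d - c|) (fun h => f (c + h) - f c).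
    by apply: fr; rewrite normr_ge0.
  rewrite (addrC c) subrK => H.
  by apply: le_trans H _; rewrite ler_wpM2r//; lra.
apply: (@le_trans _ _ (2 * L)); last by rewrite ler_peMr//; [lra|exact: ltW].
by rewrite (le_trans (ler_normB _ _))//; lra.
Qed.

End Tame.

(** * Two Bernoulli inequalities and a product estimate *)

Section Estimates.
Context {R : realType}.
Implicit Types (s u v y z : R).

Lemma expr_onep_bernoulli s n : 0 <= s -> (1 + s) ^+ n * (1 - n%:R * s) <= 1.
Proof.
move=> s0; elim: n => [|n IH]; first by rewrite expr0 mul0r subr0 mulr1.
apply: le_trans IH; rewrite exprS mulrAC mulrC ler_wpM2l ?exprn_ge0 ?addr_ge0//.
rewrite -natr1; have n0 : 0 <= n%:R :> R by [].
by have := mulr_ge0 n0 (mulr_ge0 s0 s0); have := mulr_ge0 s0 s0; lra.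
Qed.

Lemma expr_onem_bernoulli u n : 0 <= u <= 1 -> (1 - u) ^+ n * (1 + n%:R * u) <= 1.
Proof.
move=> /andP[u0 u1]; elim: n => [|n IH]; first by rewrite expr0 mul0r addr0 mulr1.
apply: le_trans IH; rewrite exprS mulrAC mulrC ler_wpM2l ?exprn_ge0 ?subr_ge0//.
rewrite -natr1; have n0 : 0 <= n%:R :> R by [].
by have := mulr_ge0 n0 (mulr_ge0 u0 u0); have := mulr_ge0 u0 u0; lra.
Qed.

Section Gaps.
Variables (v : R) (g : nat) (b : nat -> R).
Hypotheses (v1 : 1 <= v) (vg : v ^+ (2 ^ g) <= 7 / 6).
Hypotheses (b0 : forall j, 0 <= b j) (bv : forall j, b j <= v ^+ (2 ^ j)).
Hypothesis bgap : forall n, (g <= n)%N ->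
  exists2 j, (n - g <= j < n)%N & b j <= (3 / 4) ^+ (2 ^ j).

Let v0 : 0 <= v. Proof. exact: le_trans v1. Qed.

Let prod_le n : \prod_(j < n) b j <= v ^+ (2 ^ n).
Proof.
elim: n => [|n IH]; first by rewrite big_ord0 expr1.
by rewrite big_ord_recr/= expnS mul2n -addnn exprD ler_pM ?prodr_ge0.
Qed.

Let prod_le_kill n j : (j < n)%N -> b j <= (3 / 4) ^+ (2 ^ j) ->
  \prod_(i < n) b i <= (3 / 4) ^+ (2 ^ j) * v ^+ (2 ^ n).
Proof.
move=> + bj; elim: n => // n IH; rewrite ltnS leq_eqVlt => /orP[/eqP <-|jn].
  rewrite big_ord_recr/= mulrC ler_pM ?prodr_ge0//.
  by rewrite (le_trans (prod_le _))// ler_weXn2l// leq_exp2l.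
rewrite big_ord_recr/= expnS mul2n -addnn exprD mulrA.
by apply: ler_pM; rewrite ?prodr_ge0//; exact: IH.
Qed.

(** A factor of size [(3/4)^(2^j)] in every window of length [g] absorbs the
    product of all the others, because the exponents [2^j] grow geometrically. *)
Lemma prod_gap_le n : \prod_(j < n) b j <= 2 * (7 / 8) ^+ (n - g).
Proof.
have [gn|ng] := leqP g n; last first.
  have -> : (n - g = 0)%N by lia.
  rewrite expr0 mulr1 (le_trans (prod_le _))//.
  apply: (@le_trans _ _ (v ^+ (2 ^ g))); last by apply: le_trans vg _; lra.
  by rewrite ler_weXn2l// leq_exp2l// ltnW.
have [j /andP[ngj jn] bj] := bgap gn.
apply: le_trans (prod_le_kill jn bj) _.
apply: (@le_trans _ _ ((3 / 4) ^+ (2 ^ (n - g)) * (7 / 6) ^+ (2 ^ (n - g)))).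
  apply: ler_pM; rewrite ?exprn_ge0//.
    by rewrite ler_wiXn2l ?leq_exp2l//; lra.
  rewrite -[in X in X <= _](subnKC gn) expnD exprM.
  by rewrite lerXn2r// nnegrE ?exprn_ge0//; lra.
rewrite -exprMn (_ : 3 / 4 * (7 / 6) = 7 / 8 :> R); last by field.
apply: (@le_trans _ _ ((7 / 8) ^+ (n - g))).
  by rewrite ler_wiXn2l//; [lra|rewrite ltnW// ltn_expl].
by rewrite ler_peMl ?exprn_ge0//; lra.
Qed.

End Gaps.

Lemma sum_gap_le g n : \sum_(i < n) (7 / 8 : R) ^+ (i - g) <= g%:R + 8.
Proof.
(* the term [8 * (7/8)^(n - g)] is the geometric tail still to come *)
suff : \sum_(i < n) (7 / 8 : R) ^+ (i - g) + 8 * (7 / 8) ^+ (n - g) <= (minn n g)%:R + 8.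
  have : 0 <= (7 / 8 : R) ^+ (n - g) by rewrite exprn_ge0//; lra.
  have : (minn n g)%:R <= g%:R :> R by rewrite ler_nat geq_minr.
  lra.
elim: n => [|n IH]; first by rewrite big_ord0 sub0n min0n expr0; lra.
rewrite big_ord_recr/=; have [gn|ng] := leqP g n.
  rewrite subSn// exprS; move: IH; rewrite !(minn_idPr _)//; [lra|exact: leqW].
have e : (n - g = 0)%N by lia.
have e' : (n.+1 - g = 0)%N by lia.
move: IH; rewrite e e' expr0 (minn_idPl _) ?(minn_idPl ng) 1?ltnW// -natr1; lra.
Qed.

End Estimates.

(** * Binomial tails *)

Section BinomialTail.
Context {R : realType}.
Implicit Types (y z : R).

(** The probability of at least [m] successes among [k] independent trials of
    success probability [y], by conditioning on the first trial. *)
Fixpoint btail (k m : nat) y : R :=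
  if m is m'.+1 then
    if k is k'.+1 then y * btail k' m' y + (1 - y) * btail k' m y else 0
  else 1.

Lemma btail_itv k m y : 0 <= y <= 1 -> 0 <= btail k m y <= 1.
Proof.
move=> /andP[y0 y1]; elim: k m => [|k IH] [|m] /=; rewrite ?lexx ?ler01//.
have /andP[a0 a1] := IH m; have /andP[b0 b1] := IH m.+1.
have z0 : 0 <= 1 - y by lra.
have := mulr_ge0 y0 a0; have := mulr_ge0 z0 b0.
by have := ler_wpM2l y0 a1; have := ler_wpM2l z0 b1; lra.
Qed.

Lemma btail_anti k m y : 0 <= y <= 1 -> btail k m.+1 y <= btail k m y.
Proof.
move=> y01; have /andP[y0 y1] := y01; elim: k m => [|k IH] [|m] //.
  by have /andP[] := btail_itv k.+1 1 y01.
have z0 : 0 <= 1 - y by lra.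
by apply: lerD; apply: ler_wpM2l => //; exact: IH.
Qed.

Lemma btail_homo k m y z : 0 <= y -> y <= z -> z <= 1 -> btail k m y <= btail k m z.
Proof.
move=> y0 yz z1; elim: k m => [|k IH] [|m] //=.
have z01 : 0 <= z <= 1 by rewrite z1 (le_trans y0).
apply: (@le_trans _ _ (y * btail k m z + (1 - y) * btail k m.+1 z)).
  by apply: lerD; apply: ler_wpM2l => //; lra.
have d0 : 0 <= z - y by lra.
by have := ler_wpM2l d0 (btail_anti k m z01); lra.
Qed.

(** Chernoff's bound with parameter [1/2]; the recursion makes it an induction. *)
Lemma btail_lower k m y : 0 <= y <= 1 ->
  1 - btail k m y <= 2 ^+ m * (1 - y / 2) ^+ k.
Proof.
move=> /andP[y0 y1]; have h0 : 0 <= 1 - y / 2 by lra.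
elim: k m => [|k IH] [|m] /=; rewrite ?subrr ?mulr_ge0 ?exprn_ge0//.
  by rewrite subr0 expr0 mulr1 exprn_ege1//; lra.
have z0 : 0 <= 1 - y by lra.
have := ler_wpM2l y0 (IH m); have := ler_wpM2l z0 (IH m.+1).
rewrite !exprS; set B := (1 - y / 2) ^+ k; lra.
Qed.

(** Chernoff's bound again, which survives in the norm because all coefficients of
    the recursion in [f] and [1 - f] are nonnegative. With [z = 1] it says that
    the norm exceeds [1] by little, with [z = 2] that it is small when [f] is. *)
Lemma maj_btail (X : normedModType R) (f : X -> R) r a b z k m :
  0 <= r -> 1 <= z -> 1 <= a + b ->
  maj r a f -> maj r b (fun h => 1 - f h) ->
  maj r (z^-1 ^+ m * (z * a + b) ^+ k) (fun h => btail k m (f h)).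
Proof.
move=> r0 z1 ab1 fa fb.
have a0 := maj_ge0 r0 fa; have b0 := maj_ge0 r0 fb.
have zpos : 0 < z by exact: lt_le_trans z1.
have zab1 : 1 <= z * a + b by apply: le_trans ab1 _; rewrite lerD2r ler_peMl.
have zab0 : 0 <= z * a + b by exact: le_trans zab1.
elim: k m => [|k IH] [|m].
- by apply: MajLe (maj_cst r 1) _ _ => //; rewrite normr1 !expr0 mulr1.
- apply: MajLe (maj_cst r 0) _ _ => //; rewrite normr0 expr0 mulr1 exprn_ge0//.
  by rewrite invr_ge0 ltW.
- by apply: MajLe (maj_cst r 1) _ _ => //; rewrite normr1 expr0 mul1r exprn_ege1.
- apply: MajLe (MajAdd (maj_mul r0 fa (IH m)) (maj_mul r0 fb (IH m.+1))) _ _ => //.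
  rewrite le_eqVlt; apply/orP; left; apply/eqP; rewrite !exprS; field.
  by rewrite gt_eqF.
Qed.

End BinomialTail.

(** * The colour of the first success *)

Section FirstHit.
Context {R : realType}.
Implicit Types (c : nat -> bool) (e : nat -> R).

(** If trial [i] fails with probability [e i], independently of the others, this
    is the probability that one of the first [n] trials succeeds and that the
    first one to do so has the colour [c]. *)
Definition first_hit c e n := \sum_(i < n | c i) (\prod_(j < i) e j) * (1 - e i).

Lemma first_hitS c e n : first_hit c e n.+1 =
  (c 0)%:R * (1 - e 0) + e 0 * first_hit (c \o succn) (e \o succn) n.
Proof.
rewrite /first_hit big_mkcond big_ord_recl/= big_ord0 mul1r; congr (_ + _).
  by case: (c 0); rewrite ?mul1r ?mul0r.
rewrite -big_mkcond/= [in RHS]big_mkcond/= mulr_sumr big_mkcond/=.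
apply: eq_bigr => i _; case: (c _); rewrite ?mulr0//.
by rewrite big_ord_recl mulrA.
Qed.

Lemma first_hit_itv c e n : (forall i, 0 <= e i <= 1) -> 0 <= first_hit c e n <= 1.
Proof.
elim: n c e => [|n IH] c e e01; first by rewrite /first_hit big_ord0 lexx ler01.
rewrite first_hitS; have /andP[h0 h1] := IH (c \o succn) (e \o succn) (fun i => e01 i.+1).
have /andP[a0 a1] := e01 0; have := mulr_ge0 a0 h0; have := ler_wpM2l a0 h1.
by case: (c 0); rewrite ?mul1r ?mul0r; lra.
Qed.

(** Once the earlier trials have failed, trial [i] chooses between its own outcome,
    [1] for the colour [c] and [0] otherwise, and the probability in [[0, 1]] that
    [c] wins later; so the sign of its influence depends on its colour only. *)
Lemma first_hit_anti c e e' n :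
  (forall i, 0 <= e i <= 1) -> (forall i, 0 <= e' i <= 1) ->
  (forall i, if c i then e i <= e' i else e' i <= e i) ->
  first_hit c e' n <= first_hit c e n.
Proof.
elim: n c e e' => [|n IH] c e e' e01 e01' ee'; first by rewrite /first_hit !big_ord0.
rewrite !first_hitS.
have le := IH (c \o succn) (e \o succn) (e' \o succn)
  (fun i => e01 i.+1) (fun i => e01' i.+1) (fun i => ee' i.+1).
have /andP[h0 h1] := first_hit_itv (c \o succn) n (fun i => e01 i.+1).
move: le h0 h1; set h := first_hit _ (e \o _) _; set h' := first_hit _ (e' \o _) _.
move=> le h0 h1; have /andP[a0 a1] := e01 0; have /andP[b0 b1] := e01' 0.
have := ler_wpM2l b0 le; have := ee' 0; case: (c 0) => ab; rewrite ?mul1r ?mul0r.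
  have d0 : 0 <= e' 0 - e 0 by lra.
  by have := ler_wpM2l d0 h1; lra.
have d0 : 0 <= e 0 - e' 0 by lra.
by have := mulr_ge0 d0 h0; lra.
Qed.

Lemma first_hit_total c e n :
  first_hit c e n + first_hit (predC c) e n = 1 - \prod_(j < n) e j.
Proof.
elim: n => [|n IH]; first by rewrite /first_hit !big_ord0 subrr addr0.
rewrite /first_hit -(bigID (fun i : 'I_n.+1 => c i) predT)/= in IH *.
rewrite big_ord_recr/= -(bigID (fun i : 'I_n => c i) predT)/= in IH *.
by rewrite IH big_ord_recr/=; ring.
Qed.

Lemma first_hit_le c e n : (forall i, 0 <= e i <= 1) ->
  first_hit c e n <= \sum_(i < n | c i) (1 - e i).
Proof.
move=> e01; apply: ler_sum => i _; have /andP[a0 a1] := e01 i.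
by rewrite ler_piMl ?subr_ge0// prodr_ile1.
Qed.

Lemma maj_first_hit (X : normedModType R) c (e : nat -> X -> R) (B : nat -> R) r n :
  0 <= r -> (forall i, maj r (B i) (fun h => \prod_(j < i) e j h)) ->
  maj r (\sum_(i < n) (B i + B i.+1)) (fun h => first_hit c (e ^~ h) n).
Proof.
move=> r0 eB.
have B0 i : 0 <= B i := maj_ge0 r0 (eB i).
have H : maj r (\sum_(i < n | c i) (B i + B i.+1))
    (fun h => \sum_(i < n | c i) (\prod_(j < i) e j h - \prod_(j < i.+1) e j h)).
  by apply: maj_sum => i _; exact: maj_sub.
apply: MajLe H _ _ => [|h].
  by rewrite big_mkcond/=; apply: ler_sum => i _; case: ifP => // _; exact: addr_ge0.
by apply: eq_bigr => i _; rewrite big_ord_recr/=; ring.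
Qed.

End FirstHit.

(** * Separation of two sets of sample points *)

(** Comparing averages over a grid after a shift by [l] steps: the first [l] terms,
    which have no counterpart, cost at most [1] each. *)
Lemma ler_sum_shift (R : realType) (F F' : nat -> R) (l m : nat) :
  (forall i, (i < m)%N -> 0 <= F i) -> (forall i, (i < m)%N -> F' i <= 1) ->
  (forall i, (l <= i < m)%N -> F' i <= F (i - l)%N) ->
  \sum_(i < m) F' i <= l%:R + \sum_(i < m) F i.
Proof.
move=> F0 F1 FF.
have le1 k : (k <= m)%N -> \sum_(0 <= i < k) F' i <= k%:R.
  move=> km; apply: (@le_trans _ _ (\sum_(0 <= i < k) 1)); last first.
    by rewrite sumr_const_nat subn0.
  by rewrite !big_nat ler_sum// => i /andP[_ ik]; rewrite F1// (leq_trans ik).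
have S0 k : (k <= m)%N -> 0 <= \sum_(0 <= i < k) F i.
  by move=> km; rewrite big_nat sumr_ge0// => i /andP[_ ik]; rewrite F0// (leq_trans ik).
rewrite -!(big_mkord predT); have [ml|lm] := leqP m l.
  by apply: ler_wpDr; [exact: S0|rewrite (le_trans (le1 _ _))// ler_nat].
rewrite (big_cat_nat _ (n := l)) ?(ltnW lm)//= lerD ?le1 1?ltnW//.
rewrite -{1}[l]add0n big_addn [leRHS](big_cat_nat _ (n := (m - l)%N)) ?leq_subr//=.
apply: ler_wpDr.
  rewrite big_nat sumr_ge0// => i /andP[_ im]; exact: F0.
rewrite !big_nat ler_sum// => i /andP[_ im].
by rewrite -[X in F X](addnK l); apply: FF; lia.
Qed.

Section Separation.
Context {R : realType} {X : normedModType R}.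
Variables (G : set X) (Q : X -> R) (D : R) (pts : nat -> X) (c : nat -> bool) (N : nat).
Hypotheses (D0 : 0 <= D) (GD : forall x j, G x -> `|x - pts j| <= D).
Hypotheses (Qtame : tame Q) (Q00 : Q 0 = 0) (Q0 : forall u, 0 <= Q u)
  (Q1 : forall u, `|u| <= D -> Q u <= 1 / 2).
Hypothesis N0 : (0 < N)%N.
Hypothesis ptsG : forall x e, G x -> 0 < e -> exists g, forall n, (g <= n)%N ->
  exists2 j, (n - g <= j < n)%N & `|x - pts j| < e.

Let w : R := (8 * N%:R)^-1.

(** The threshold [t] enters with opposite signs for the two colours, as the two
    monotonicities of [first_hit_anti] require. *)
Definition fuzzy j t x := Q (x - pts j) + w * (if c j then t else 1 - t).

(** A trial misses when the binomial count reaches [2 ^ j]. The mean count is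
    [N * fuzzy] times this target, and [N * fuzzy] is at most [1 / 4] for a near
    point and at least [62] for a far one. *)
Definition miss t x j := btail (N * 2 ^ j) (2 ^ j) (fuzzy j t x).

Definition average n x :=
  n.+1%:R^-1 * \sum_(i < n.+1) first_hit c (miss (i%:R / n.+1%:R) x) n.

Let NR0 : 0 < N%:R :> R. Proof. by rewrite ltr0n. Qed.

Let w0 : 0 < w. Proof. by rewrite invr_gt0 mulr_gt0. Qed.

Let Nw : N%:R * w = 1 / 8.
Proof. by rewrite /w; field; rewrite gt_eqF. Qed.

Let w8 : w <= 1 / 8.
Proof. by rewrite -Nw ler_peMl ?(ltW w0) ?ler1n. Qed.

Lemma fuzzy_bounds j t x : 0 <= t <= 1 ->
  Q (x - pts j) <= fuzzy j t x <= Q (x - pts j) + w.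
Proof.
move=> /andP[t0 t1]; rewrite /fuzzy lerDl lerD2l.
have s0 : 0 <= (if c j then t else 1 - t) by case: ifP => _; lra.
have s1 : (if c j then t else 1 - t) <= 1 by case: ifP => _; lra.
by rewrite mulr_ge0 ?(ltW w0)//= ler_piMr// ltW.
Qed.

Lemma fuzzy_itv j t x : G x -> 0 <= t <= 1 -> 0 <= fuzzy j t x <= 1.
Proof.
move=> Gx t01; have /andP[a b] := fuzzy_bounds j x t01.
by have := Q0 (x - pts j); have := Q1 (GD j Gx); have := w8; lra.
Qed.

Lemma miss_itv j t x : G x -> 0 <= t <= 1 -> 0 <= miss t x j <= 1.
Proof. by move=> Gx t01; apply: btail_itv; exact: fuzzy_itv. Qed.

(** The false successes are summable, already because the sharpness [2 ^ j] is at
    least [j + 1]. *)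
Lemma far_sum (P : pred nat) t x n : G x -> 0 <= t <= 1 ->
  (forall j, P j -> 62 / N%:R <= Q (x - pts j)) ->
  \sum_(j < n | P j) (1 - miss t x j) <= 1 / 8.
Proof.
move=> Gx t01 far.
have far1 j : P j -> 1 - miss t x j <= (1 / 16) ^+ j.+1.
  move=> /far fj; have y01 := fuzzy_itv j Gx t01; have /andP[y0 y1] := y01.
  have /andP[Qy _] := fuzzy_bounds j x t01.
  apply: le_trans (btail_lower _ _ y01) _.
  rewrite exprM -exprMn; set y := fuzzy j t x in y0 y1 Qy *.
  have Ny : 62 <= N%:R * y.
    by rewrite -ler_pdivrMl// mulrC (le_trans fj).
  have u01 : 0 <= y / 2 <= 1 by lra.
  have Bp : 0 <= (1 - y / 2) ^+ N by rewrite exprn_ge0//; lra.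
  (* this is where [62 = 2 * (32 - 1)] comes from *)
  have B : (1 - y / 2) ^+ N <= 1 / 32.
    have := expr_onem_bernoulli N u01; have := ler_wpM2l Bp Ny.
    by lra.
  apply: (@le_trans _ _ ((1 / 16) ^+ (2 ^ j))).
    by rewrite lerXn2r// ?nnegrE ?mulr_ge0//; lra.
  by rewrite ler_wiXn2l//; [lra|exact: ltn_expl].
apply: (@le_trans _ _ (\sum_(j < n) (1 / 16 : R) ^+ j.+1)).
  rewrite big_mkcond/=; apply: ler_sum => i _; case: ifP => [/far1//|_].
  by rewrite exprn_ge0//; lra.
(* the exact value of the geometric sum, cleared of denominators *)
suff : 15 * \sum_(j < n) (1 / 16 : R) ^+ j.+1 + (1 / 16) ^+ n = 1.
  have : 0 <= (1 / 16 : R) ^+ n by rewrite exprn_ge0//; lra.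
  lra.
elim: n => [|n IH]; first by rewrite big_ord0 expr0; lra.
by rewrite big_ord_recr/= exprS; lra.
Qed.

(** The radius depends on the gap [g] of the near sample points, through [rho]: the
    surplus [(1 + 2 * rho) ^ (N * 2 ^ g)] that the other trials of a window of
    length [g] may bring must not outweigh the gain of one near trial. *)
Lemma maj_prod_miss x : G x -> exists2 r : R, 0 < r & exists g,
  forall t n, 0 <= t <= 1 ->
  maj r (2 * (7 / 8) ^+ (n - g)) (fun h => \prod_(j < n) miss t (x + h) j).
Proof.
move=> Gx.
have [L1 L10 QL1] := tame_lipschitz Qtame (@ler01 R).
have L11 : 0 < L1 + 1 by lra.
pose e := Num.min 1 (w / (L1 + 1)).
have e0 : 0 < e by rewrite lt_min ltr01 divr_gt0.
have [g gap] := ptsG Gx e0.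
have near u : `|u| < e -> Q u <= w.
  rewrite lt_min => /andP[u1 uw].
  have := QL1 0 u; rewrite normr0 Q00 !subr0 ler01 ger0_norm// => /(_ isT (ltW u1)).
  move: uw; rewrite ltr_pdivlMr// => uw; have := normr_ge0 u; lra.
(* [N * 2 ^ g * rho = 1 / 36] gives both [v ^ (2 ^ g) <= 18 / 17] and, with
   [N * y j <= 1 / 4], the bound [N * (y j + 3 * rho) <= 1 / 3] at near points *)
pose rho : R := (36 * (N * 2 ^ g)%:R)^-1.
have K0 : 0 < (N * 2 ^ g)%:R :> R by rewrite ltr0n muln_gt0 N0 expn_gt0.
have rho0 : 0 < rho by rewrite invr_gt0 mulr_gt0.
have Krho : (N * 2 ^ g)%:R * rho = 1 / 36.
  by rewrite /rho invfM mulrCA mulfV ?gt_eqF// mulr1 div1r.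
have Nrho : N%:R * rho <= 1 / 36.
  by rewrite -Krho ler_wpM2r ?(ltW rho0)// ler_nat leq_pmulr// expn_gt0.
have [L2 L20 QL2] := Qtame D0.
have L21 : 0 < L2 + 1 by lra.
pose r := Num.min 1 (rho / (L2 + 1)).
have r0 : 0 < r by rewrite lt_min ltr01 divr_gt0.
have r1 : r <= 1 by rewrite ge_min lexx.
have Lr : L2 * r <= rho.
  have : r <= rho / (L2 + 1) by rewrite ge_min lexx orbT.
  by rewrite ler_pdivlMr//; lra.
exists r => //; exists g => t n t01.
pose y j := fuzzy j t x.
have y01 j : 0 <= y j <= 1 by exact: fuzzy_itv.
have ymaj j : maj r (y j + rho) (fun h => fuzzy j t (x + h)) /\
    maj r (1 - y j + rho) (fun h => 1 - fuzzy j t (x + h)).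
  have [_ /(_ r)] := QL2 _ (GD j Gx); rewrite r1 (ltW r0) => /(_ isT) inc.
  have /andP[y0 y1] := y01 j.
  split.
    apply: MajLe (MajAdd (maj_cst r (y j)) inc) _ _ => [|h].
      by rewrite ger0_norm// lerD2l.
    by rewrite /y /fuzzy (addrAC x h); ring.
  apply: MajLe (maj_sub (ltW r0) (maj_cst r (1 - y j)) inc) _ _ => [|h].
    by rewrite ger0_norm ?subr_ge0// lerD2l.
  by rewrite /y /fuzzy (addrAC x h); ring.
pose v := (1 + 2 * rho) ^+ N.
have v1 : 1 <= v by rewrite exprn_ege1//; lra.
pose b j := if y j <= 2 * w then (3 / 4) ^+ (2 ^ j) else v ^+ (2 ^ j).
have b0 j : 0 <= b j.
  by rewrite /b; case: ifP => _; rewrite exprn_ge0//; lra.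
have bv j : b j <= v ^+ (2 ^ j).
  rewrite /b; case: ifP => // _; apply: (@le_trans _ _ 1).
    by rewrite exprn_ile1//; lra.
  by rewrite exprn_ege1.
have vg : v ^+ (2 ^ g) <= 7 / 6.
  rewrite -exprM; have s0 : 0 <= 2 * rho by lra.
  have := expr_onep_bernoulli (N * 2 ^ g) s0; rewrite mulrCA Krho; lra.
have emaj j : maj r (b j) (fun h => miss t (x + h) j).
  have [ya yb] := ymaj j; have /andP[y0 y1] := y01 j.
  have ab1 : 1 <= y j + rho + (1 - y j + rho) by lra.
  rewrite /b; case: ifP => yw.
    apply: MajLe (maj_btail (N * 2 ^ j) (2 ^ j) (ltW r0) (ler1n R 2) ab1 ya yb) _ _ => //.
    rewrite exprM -exprMn lerXn2r ?nnegrE ?mulr_ge0 ?exprn_ge0//; first by lra.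
    have s0 : 0 <= y j + 3 * rho by lra.
    have := expr_onep_bernoulli N s0.
    rewrite (_ : 2 * (y j + rho) + (1 - y j + rho) = 1 + (y j + 3 * rho)); last by ring.
    set W := _ ^+ N => H.
    have W0 : 0 <= W by rewrite exprn_ge0//; lra.
    have : N%:R * (y j + 3 * rho) <= 1 / 3.
      by have := ler_wpM2l (ltW NR0) yw; have := Nw; lra.
    by move=> /(ler_wpM2l W0); lra.
  apply: MajLe (maj_btail (N * 2 ^ j) (2 ^ j) (ltW r0) (lexx 1) ab1 ya yb) _ _ => //.
  rewrite invr1 expr1n !mul1r exprM /v.
  by rewrite (_ : y j + rho + (1 - y j + rho) = 1 + 2 * rho); [exact: lexx|ring].
have bgap m : (g <= m)%N -> exists2 j, (m - g <= j < m)%N & b j <= (3 / 4) ^+ (2 ^ j).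
  move=> /gap [j jm /near jw]; exists j => //; rewrite /b ifT//.
  by have /andP[_] := fuzzy_bounds j x t01; rewrite -/(y j); lra.
apply: MajLe (_ : maj r (\prod_(j < n) b j) _) _ _ => [|//|//].
  elim: n => [|n IH].
    apply: MajLe (maj_cst r 1) _ _ => [|h]; first by rewrite normr1 big_ord0.
    by rewrite big_ord0.
  rewrite big_ord_recr/=; apply: MajLe (maj_mul (ltW r0) IH (emaj n)) _ _ => // h.
  by rewrite big_ord_recr.
exact: (prod_gap_le v1 vg b0 bv bgap n).
Qed.

Lemma grid_itv i n : (i < n.+1)%N -> 0 <= (i%:R / n.+1%:R : R) <= 1.
Proof.
move=> il; rewrite divr_ge0//= ler_pdivrMr ?ltr0n// mul1r ler_nat ltnW//.
Qed.

Lemma average_le n x a :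
  (forall t, 0 <= t <= 1 -> first_hit c (miss t x) n <= a) -> average n x <= a.
Proof.
move=> le_a; rewrite /average mulrC ler_pdivrMr ?ltr0n//.
apply: (@le_trans _ _ (\sum_(i < n.+1) a)).
  by apply: ler_sum => i _; apply: le_a; exact: grid_itv.
by rewrite sumr_const card_ord mulr_natr.
Qed.

Lemma average_ge n x a :
  (forall t, 0 <= t <= 1 -> a <= first_hit c (miss t x) n) -> a <= average n x.
Proof.
move=> ge_a; rewrite /average mulrC ler_pdivlMr ?ltr0n//.
apply: (@le_trans _ _ (\sum_(i < n.+1) a)).
  by rewrite sumr_const card_ord mulr_natr.
by apply: ler_sum => i _; apply: ge_a; exact: grid_itv.
Qed.

Lemma average_itv n x : G x -> 0 <= average n x <= 1.
Proof.
move=> Gx; rewrite average_ge ?average_le// => t t01;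
  by have /andP[] := first_hit_itv c n (fun j => miss_itv j Gx t01).
Qed.

Lemma average_far n x : G x ->
  (forall j, c j -> 62 / N%:R <= Q (x - pts j)) -> average n x <= 1 / 8.
Proof.
move=> Gx far; apply: average_le => t t01.
apply: le_trans (first_hit_le _ _ (fun j => miss_itv j Gx t01)) _.
exact: far_sum.
Qed.

(** All trials fail with a probability that tends to [0], and the wrong colour only
    wins through a false success. *)
Lemma average_near x : G x ->
  (forall j, ~~ c j -> 62 / N%:R <= Q (x - pts j)) ->
  exists g, forall n, 7 / 8 - 2 * (7 / 8) ^+ (n - g) <= average n x.
Proof.
move=> Gx far; have [r r0 [g pr]] := maj_prod_miss Gx.
exists g => n; apply: average_ge => t t01.
have := first_hit_total c (miss t x) n.
have := first_hit_le (predC c) n (fun j => miss_itv j Gx t01).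
have := far_sum n Gx t01 far.
have := maj_bound (h := 0) _ (pr t n t01); rewrite normr0 (ltW r0) addr0 => /(_ isT).
move=> /(le_trans (ler_norm _)); lra.
Qed.

(** Each term of [first_hit] is a difference of two consecutive products of failure
    probabilities, whose norms are summable. *)
Lemma average_maj x : G x -> exists2 r : R, 0 < r & exists M,
  forall n, maj r M (fun h => average n (x + h)).
Proof.
move=> Gx; have [r r0 [g pr]] := maj_prod_miss Gx.
exists r => //; exists (4 * (g%:R + 9)) => n.
pose B i : R := 2 * (7 / 8) ^+ (i - g).
have sumB m : \sum_(i < m) B i <= 2 * (g%:R + 8).
  by rewrite -mulr_sumr ler_wpM2l// sum_gap_le.
have fB t : 0 <= t <= 1 -> maj r (4 * (g%:R + 9)) (fun h => first_hit c (miss t (x + h)) n).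
  move=> t01; apply: MajLe (maj_first_hit c n (ltW r0) (fun i => pr t i t01)) _ _ => //.
  rewrite big_split/= -/(B _).
  have : \sum_(i < n) B i.+1 <= \sum_(i < n.+1) B i.
    by rewrite big_ord_recl lerDr /B mulr_ge0// exprn_ge0//; lra.
  have := sumB n; have := sumB n.+1; rewrite /B; lra.
apply: MajLe (maj_scale n.+1%:R^-1 (ltW r0)
  (maj_sum (index_enum _) (fun (i : 'I_n.+1) _ => fB _ (grid_itv (ltn_ord i))))) _ _ => //.
by rewrite sumr_const card_ord ger0_norm ?invr_ge0// -[X in _ * X]mulr_natl mulKf// pnatr_eq0.
Qed.

(** Moving from [x] to [x'] is compensated by moving the threshold [t], in the
    direction that [first_hit_anti] asks for. *)
Lemma average_lipschitz L n x x' : 0 <= L -> G x -> G x' ->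
  (forall j, `|Q (x' - pts j) - Q (x - pts j)| <= L * `|x' - x|) ->
  average n x' <= average n x + (L / w * `|x' - x| + n.+1%:R^-1).
Proof.
move=> L0 Gx Gx' QL; set delta := `|x' - x| in QL *.
have m0 : 0 < n.+1%:R :> R by rewrite ltr0n.
(* the shift of the threshold, rounded up to the grid *)
pose l := (Num.trunc (L / w * delta * n.+1%:R)).+1.
have s0 : 0 <= L / w * delta * n.+1%:R.
  by rewrite !mulr_ge0 ?invr_ge0 ?(ltW w0) ?normr_ge0.
have lge : L * delta <= w * (l%:R / n.+1%:R).
  rewrite mulrA ler_pdivlMr//.
  have : L / w * delta * n.+1%:R <= l%:R by rewrite ltW// /l truncnS_gt.
  by move=> /(ler_wpM2l (ltW w0)); rewrite !mulrA; apply: le_trans;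
    rewrite [w * L]mulrC mulfK // gt_eqF.
have lle : l%:R <= L / w * delta * n.+1%:R + 1.
  by rewrite /l -natr1 lerD2r truncn_le.
rewrite /average mulrC ler_pdivrMr// mulrDl mulrAC mulVf ?gt_eqF// mul1r.
rewrite [X in _ <= _ + X]mulrDl mulVf ?gt_eqF//.
pose F i := first_hit c (miss (i%:R / n.+1%:R) x) n.
pose F' i := first_hit c (miss (i%:R / n.+1%:R) x') n.
have FF i : (l <= i < n.+1)%N -> F' i <= F (i - l)%N.
  move=> /andP[li im].
  have t01 : 0 <= (i%:R / n.+1%:R : R) <= 1 by exact: grid_itv.
  have t01' : 0 <= ((i - l)%:R / n.+1%:R : R) <= 1.
    by apply: grid_itv; exact: leq_ltn_trans (leq_subr _ _) im.
  apply: first_hit_anti => [j|j|j]; [exact: miss_itv|exact: miss_itv|].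
  have := QL j; rewrite ler_norml => /andP[Qa Qb].
  have e : (i - l)%:R / n.+1%:R = i%:R / n.+1%:R - l%:R / n.+1%:R :> R.
    by rewrite natrB// mulrBl.
  case: ifP => cj; rewrite /miss; apply: btail_homo.
  - by have /andP[] := fuzzy_itv j Gx t01'.
  - rewrite /fuzzy cj e mulrBr; move: lge Qa; set p := w * _; set q := w * _; lra.
  - by have /andP[] := fuzzy_itv j Gx' t01.
  - by have /andP[] := fuzzy_itv j Gx' t01.
  - rewrite /fuzzy cj e !mulrBr; move: lge Qb; set p := w * _; set q := w * (i%:R / _); lra.
  - by have /andP[] := fuzzy_itv j Gx t01'.
apply: (@le_trans _ _ (l%:R + \sum_(i < n.+1) F i)).
  apply: (@ler_sum_shift _ F F') => // i im.
    by have /andP[] := first_hit_itv c n (fun j => miss_itv j Gx (grid_itv im)).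
  by have /andP[] := first_hit_itv c n (fun j => miss_itv j Gx' (grid_itv im)).
by rewrite addrC lerD2l.
Qed.

(** An ultrafilter avoids proving that the averages converge; every property of
    them that is needed passes to limits along it. *)
Lemma analytic_separation : exists H : X -> R,
  [/\ forall x, G x -> power_series_at x H,
      exists2 L, 0 <= L & forall x y, G x -> G y -> `|H x - H y| <= L * `|x - y|,
      forall x, G x -> 0 <= H x <= 1,
      forall x, G x -> (forall j, c j -> 62 / N%:R <= Q (x - pts j)) -> H x <= 1 / 8
    & forall x, G x -> (forall j, ~~ c j -> 62 / N%:R <= Q (x - pts j)) -> 7 / 8 <= H x].
Proof.
have [U [UU ooU]] := ultraFilterLemma eventually_filter.
pose H x := lim (average n x @[n --> U]).
have cvgH x : G x -> average n x @[n --> U] --> H x.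
  move=> Gx; apply: (ultra_bounded_cvg UU (M := 1)) => n.
  by have /andP[a0 a1] := average_itv n Gx; rewrite ger0_norm.
have cvgU (u : nat -> R) (a : R) : u @ \oo --> a -> u @ U --> a.
  by move=> ua; apply: cvg_trans ua; exact: cvg_app ooU.
have HleU x (u : nat -> R) (a : R) : G x -> u @ \oo --> a ->
    (forall n, average n x <= u n) -> H x <= a.
  by move=> Gx ua; apply: filter_lim_le (cvgH x Gx) (cvgU _ _ ua).
have HgeU x (u : nat -> R) (a : R) : G x -> u @ \oo --> a ->
    (forall n, u n <= average n x) -> a <= H x.
  by move=> Gx ua; apply: filter_lim_le (cvgU _ _ ua) (cvgH x Gx).
exists H; split.
- move=> x Gx; have [r r0 [M fM]] := average_maj Gx.
  exact: (maj_ultra_limit UU r0 fM).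
- have [L L0 QL] := tame_lipschitz Qtame D0.
  exists (L / w); first by rewrite divr_ge0// ltW.
  have half x y : G x -> G y -> H x - H y <= L / w * `|x - y|.
    move=> Gx Gy.
    have QL' j : `|Q (x - pts j) - Q (y - pts j)| <= L * `|x - y|.
      have := QL _ _ (GD j Gy) (GD j Gx).
      by rewrite opprB addrA subrK.
    have cn : L / w * `|x - y| + n.+1%:R^-1 @[n --> U] --> L / w * `|x - y| + 0.
      by apply: cvgD; [exact: cvg_cst|apply: cvgU; exact: cvg_harmonic].
    have := filter_lim_le (cvgB (cvgH x Gx) (cvgH y Gy)) cn; rewrite addr0; apply.
    by move=> n; have := average_lipschitz n L0 Gy Gx QL'; rewrite !fctE lerBlDl.
  move=> x y Gx Gy; rewrite ler_norml; have := half x y Gx Gy.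
  by have := half y x Gy Gx; rewrite distrC; lra.
- move=> x Gx; apply/andP; split.
    by apply: (HgeU x (fun=> 0)) => // [|n]; [exact: cvg_cst|have /andP[] := average_itv n Gx].
  by apply: (HleU x (fun=> 1)) => // [|n]; [exact: cvg_cst|have /andP[] := average_itv n Gx].
- move=> x Gx far; apply: (HleU x (fun=> 1 / 8)) => // [|n]; first exact: cvg_cst.
  exact: average_far.
- move=> x Gx far; have [g ge] := average_near Gx far.
  apply: (HgeU x _ _ Gx _ ge).
  rewrite -[X in _ --> X]subr0; apply: cvgB; first exact: cvg_cst.
  rewrite -(cvg_shiftn g)/=; under eq_fun do rewrite addnK.
  by apply: (@cvg_geometric R 2 (7 / 8)); rewrite ger0_norm; lra.
Qed.

End Separation.

(** * Separating polynomials *)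

(** The sum of the squares of the homogeneous parts: along a ray each square only
    grows with the norm, so a lower bound on the sphere, which the separating
    polynomial provides, propagates outwards and, up to a factor, inwards. *)
Lemma separating_polynomial_tame (R : realType) (X : normedModType R) (q : X -> R) :
  separating_polynomial q -> exists Q : X -> R,
  [/\ tame Q, Q 0 = 0, forall u, 0 <= Q u
    & forall d, 0 < d -> exists2 k, 0 < k & forall u, d <= `|u| -> k <= Q u].
Proof.
move=> [[n [P [Phom qP]]] q0 qinf].
have [c c0 qc] : exists2 c : R, 0 < c & forall e, `|e| = 1 -> c <= `|q e|.
  set S := [set _ | _ in _] in qinf.
  have lb e : `|e| = 1 -> (ereal_inf S <= `|q e|%:E)%E.
    by move=> e1; apply: ereal_inf_lbound; exists e.
  move: qinf lb; case: (ereal_inf S) => [c| |] //.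
    by rewrite lte_fin => c0 lb; exists c => // e /lb; rewrite lee_fin.
  by move=> _ lb; exists 1 => // e /lb; rewrite leye_eq.
have /choice [A /choice [C AC]] : forall i, exists A C, (i <= n)%N ->
    mlform i A C /\ forall x, P i x = A (fun=> x).
  move=> i; have [/Phom /homogeneous_mlform [A [C AC]]|//] := leqP i n.
    by exists A, C.
  by exists (fun=> 0), 0.
have Ps i s x : (i <= n)%N -> P i (s *: x) = s ^+ i * P i x.
  move=> /AC [Af PA]; rewrite !PA (multilinear_scale (mlform_ext Af) (mlform_lin Af) (fun=> s)).
  by rewrite prodr_const card_ord.
have P0 i : (0 < i <= n)%N -> P i 0 = 0.
  by move=> /andP[i0 iin]; rewrite -(scale0r 0) Ps// expr0n gtn_eqF// mul0r.
have P00 x : P 0 x = 0.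
  have [Af PA] := AC 0 (leq0n n).
  rewrite PA (mlform_ext Af (w := fun=> 0))// -PA -q0 qP big_ord_recl big1 ?addr0//= => i _.
  by apply: P0; have := ltn_ord i; rewrite /bump /=; lia.
exists (fun u => \sum_(i < n.+1) P i u * P i u); split.
- apply: (@tame_sum _ _ _ (fun i u => P i u * P i u)) => i; rewrite ltnS => /AC [Af PA].
  by rewrite (_ : P i = fun x => A i (fun=> x)); [apply: tame_mul; exact: mlform_tame Af|exact: funext].
- rewrite big1// => -[[|i] /= ilt] _; first by rewrite P00 mul0r.
  by rewrite P0 ?mul0r.
- by move=> u; apply: sumr_ge0 => i _; rewrite -expr2 sqr_ge0.
move=> d d0; pose m := Num.min 1 d.
have m0 : 0 < m by rewrite lt_min ltr01.
have m1 : m <= 1 by rewrite ge_min lexx.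
pose lam := c / n.+1%:R.
have lam0 : 0 < lam by rewrite divr_gt0.
exists (m ^+ n * m ^+ n * (lam * c)); first by rewrite !mulr_gt0// exprn_gt0.
move=> u du; pose s := `|u|.
have s0 : 0 < s by exact: lt_le_trans du.
pose e := s^-1 *: u.
have ue : u = s *: e by rewrite /e scalerA mulfV ?scale1r// gt_eqF.
have e1 : `|e| = 1.
  by rewrite normrZ ger0_norm ?invr_ge0 ?ltW// mulVf// gt_eqF.
have Se : lam * c <= \sum_(i < n.+1) P i e * P i e.
  (* the arithmetic-geometric inequality, with weight [lam], in place of
     Cauchy-Schwarz *)
  have : 2 * lam * `|q e| <= \sum_(i < n.+1) (lam * lam + P i e * P i e).
    rewrite qP; apply: (@le_trans _ _ (\sum_(i < n.+1) 2 * lam * `|P i e|)).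
      by rewrite -mulr_sumr; apply: ler_wpM2l; [rewrite mulr_ge0 ?(ltW lam0)|exact: ler_norm_sum].
    apply: ler_sum => i _; have -> : P i e * P i e = `|P i e| * `|P i e|.
      by rewrite -normrM ger0_norm// -expr2 sqr_ge0.
    have := sqr_ge0 (lam - `|P i e|); lra.
  rewrite big_split/= sumr_const card_ord.
  rewrite (_ : lam * lam *+ n.+1 = c * lam); last first.
    by rewrite -mulrnAl -[lam *+ _]mulr_natr /lam divfK ?pnatr_eq0.
  have := qc e e1 => /(ler_wpM2l (ltW lam0)).
  lra.
apply: (@le_trans _ _ (m ^+ n * m ^+ n * \sum_(i < n.+1) P i e * P i e)).
  by rewrite ler_wpM2l// mulr_ge0// exprn_ge0// ltW.
rewrite mulr_sumr; apply: ler_sum => i _.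
have iin : (i <= n)%N by rewrite -ltnS.
have -> : P i u = s ^+ i * P i e by rewrite {1}ue Ps.
rewrite [leRHS]mulrACA -!expr2 ler_wpM2r ?sqr_ge0//.
rewrite lerXn2r// ?nnegrE ?exprn_ge0 ?(ltW m0) ?(ltW s0)//.
apply: (@le_trans _ _ (m ^+ i)).
  by rewrite ler_wiXn2l// ltW.
by rewrite lerXn2r// ?nnegrE ?(ltW m0) ?(ltW s0)// ge_min du orbT.
Qed.

(** * Sampling a separable set *)

(** Enumerate a dense sequence along the ruler sequence: the index [j] carries its
    term number [logn 2 j.+1], and the integers of a given 2-adic valuation form
    an arithmetic progression. *)
Lemma syndetic_sampling (R : realType) (X : normedModType R) (G : set X) :
  separable_space X -> open G -> G !=set0 ->
  exists pts : nat -> X, (forall j, G (pts j)) /\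
    forall x e, G x -> 0 < e -> exists g, forall n, (g <= n)%N ->
      exists2 j, (n - g <= j < n)%N & `|x - pts j| < e.
Proof.
move=> [S /countable_injP [f finj] Sdense] Go [g0 Gg0].
pose p k := xget g0 [set d | [/\ S d, G d & f d = k]].
exists (fun j => p (logn 2 j.+1)); split.
  by move=> j; rewrite /p; case: xgetP => [d _ []|].
move=> x e Gx e0.
have [d [[xd Gd] Sd]] : (ball x e `&` G) `&` S !=set0.
  apply: Sdense; last by apply: openI => //; exact: ball_open.
  by exists x; split => //; exact: ballxx.
have pd : p (f d) = d.
  rewrite /p; case: xgetP => [d' _ [Sd' _ fd]|/(_ d)]; last by case.
  by apply: finj => //; exact: mem_set.
(* twice the period, so that the last full period before [n] lies in the window *)
exists (2 ^ (f d).+2)%N => n gn.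
pose m := (n %/ 2 ^ (f d).+1)%N.
have k0 : (0 < 2 ^ (f d))%N by rewrite expn_gt0.
have m1 : (0 < m)%N.
  by rewrite divn_gt0 ?expn_gt0// (leq_trans _ gn)// leq_exp2l.
have ndef : (n = m * (2 * 2 ^ (f d)) + n %% 2 ^ (f d).+1)%N by rewrite -expnS -divn_eq.
have nlt : (n %% 2 ^ (f d).+1 < 2 * 2 ^ (f d))%N by rewrite -expnS ltn_mod expn_gt0.
have jdef : (0 < 2 ^ f d * (m.-1.*2).+1)%N by rewrite muln_gt0 k0.
exists (2 ^ f d * (m.-1.*2).+1).-1.
  rewrite (expnS 2 (f d).+1) (expnS 2 (f d)) in gn *.
  by apply/andP; split; nia.
rewrite prednK// lognM// pfactorK// logn_coprime ?coprime2n/= ?odd_double// addn0 pd.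
by move: xd; rewrite -ball_normE.
Qed.

(** * Approximation *)

Section Approximation.
Context {R : realType} {X : normedModType R}.
Variables (G : set X).
Implicit Types (F K : X -> R).

Definition uniform_on F := forall e, 0 < e -> exists2 d, 0 < d &
  forall x y, G x -> G y -> `|x - y| < d -> `|F x - F y| < e.

Definition lipschitz_bound_on K := exists2 L : R, 0 <= L &
  forall x y, G x -> G y -> `|K x - K y| <= L * `|x - y|.

Lemma lipschitz_bound_lin K1 K2 b : lipschitz_bound_on K1 -> lipschitz_bound_on K2 ->
  lipschitz_bound_on (fun x => K1 x + b * K2 x).
Proof.
move=> [L L0 K1L] [M M0 K2M]; exists (L + `|b| * M); first by rewrite addr_ge0// mulr_ge0.
move=> x y Gx Gy.
rewrite (_ : K1 x + _ - _ = K1 x - K1 y + b * (K2 x - K2 y)); last by ring.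
rewrite (le_trans (ler_normD _ _))// mulrDl lerD ?K1L//.
by rewrite normrM -mulrA ler_wpM2l// K2M.
Qed.

Lemma uniform_subl F K : uniform_on F -> lipschitz_bound_on K ->
  uniform_on (fun x => F x - K x).
Proof.
move=> Fu [L L0 KL] e e0; have [|d d0 Fd] := Fu (e / 2); first by rewrite divr_gt0.
have L1 : 0 < L + 1 by lra.
exists (Num.min d (e / 2 / (L + 1))); first by rewrite lt_min d0 !divr_gt0.
move=> x y Gx Gy; rewrite lt_min => /andP[xd xe].
rewrite (_ : F x - K x - _ = F x - F y + (K y - K x)); last by ring.
apply: le_lt_trans (ler_normD _ _) _.
have := Fd x y Gx Gy xd; have := KL y x Gy Gx; rewrite (distrC y).
by move: xe; rewrite ltr_pdivlMr// => ?; have := normr_ge0 (x - y); lra.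
Qed.

Hypothesis Gsep : forall F M, 0 < M -> uniform_on F -> exists H : X -> R,
  [/\ forall x, G x -> power_series_at x H, lipschitz_bound_on H,
      forall x, G x -> 0 <= H x <= 1,
      forall x, G x -> F x <= - M -> H x <= 1 / 8
    & forall x, G x -> M <= F x -> 7 / 8 <= H x].

(** Tietze's iteration. The remainder stays uniformly continuous because the
    functions subtracted are Lipschitz. *)
Lemma tietze_iteration n F M : 0 < M -> uniform_on F ->
  (forall x, G x -> `|F x| <= M) ->
  exists K, [/\ forall x, G x -> power_series_at x K, lipschitz_bound_on K
    & forall x, G x -> `|F x - K x| <= (3 / 4) ^+ n * M].
Proof.
elim: n F M => [|n IH] F M M0 Fu FM.
  exists (fun=> 0); split; first by move=> x _; exact: power_series_cst.
    by exists 0 => // x y _ _; rewrite subrr normr0 mul0r.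
  by move=> x Gx; rewrite subr0 expr0 mul1r FM.
have M3 : 0 < M / 3 by lra.
have [H [Ha Hl H01 Hlo Hhi]] := Gsep M3 Fu.
(* [H] rescaled from [[0, 1]] to [[- M / 3, M / 3]] *)
pose K1 x := - (M / 3) + 2 * M / 3 * H x.
have K1l : lipschitz_bound_on K1.
  apply: (@lipschitz_bound_lin (fun=> _)) => //.
  by exists 0 => // x y _ _; rewrite subrr normr0 mul0r.
have FK1 x : G x -> `|F x - K1 x| <= 3 / 4 * M.
  move=> Gx; have := FM x Gx; have /andP[h0 h1] := H01 x Gx.
  have := ler_wpM2l (ltW M0) h0; have := ler_wpM2l (ltW M0) h1.
  rewrite !ler_norml /K1 mulr0 mulr1 => ? ? /andP[? ?].
  have [Fhi|Flo] := leP (M / 3) (F x).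
    by have /(ler_wpM2l (ltW M0)) := Hhi x Gx Fhi; lra.
  have [Fhi|Fmid] := leP (F x) (- (M / 3)).
    by have /(ler_wpM2l (ltW M0)) := Hlo x Gx Fhi; lra.
  lra.
have M34 : 0 < 3 / 4 * M by lra.
have [K2 [K2a K2l K2F]] := IH _ _ M34 (uniform_subl Fu K1l) FK1.
exists (fun x => K1 x + 1 * K2 x); split.
- move=> x Gx; apply: power_series_lin; last exact: K2a.
  by apply: power_series_lin; [exact: power_series_cst|exact: Ha].
- exact: lipschitz_bound_lin.
- by move=> x Gx; rewrite mul1r opprD addrA exprSr -mulrA K2F.
Qed.

End Approximation.

(** The colour of a sample point is the sign of [F] there: where [F] is at least
    [M], or at most [- M], all points of the opposite colour are far away by
    uniform continuity. *)
Lemma separating_uniform_levels (R : realType) (X : normedModType R) (G : set X) :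
  separable_space X -> (exists q : X -> R, separating_polynomial q) ->
  open G -> bounded_set G -> G !=set0 ->
  forall (F : X -> R) (M : R), 0 < M -> uniform_on G F -> exists H : X -> R,
  [/\ forall x, G x -> power_series_at x H, lipschitz_bound_on G H,
      forall x, G x -> 0 <= H x <= 1,
      forall x, G x -> F x <= - M -> H x <= 1 / 8
    & forall x, G x -> M <= F x -> 7 / 8 <= H x].
Proof.
move=> Xsep [q /separating_polynomial_tame [Q [Qt Q00 Q0 Qfar]]] Go Gb G0 F M M0 Fu.
have [pts [Gpts ptsG]] := syndetic_sampling Xsep Go G0.
have [B B0 GB] : exists2 B : R, 0 < B & forall x, G x -> `|x| <= B.
  by have /pinfty_ex_gt0 [B B0 GB] := Gb; exists B.
have D0 : 0 <= 2 * B by lra.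
have GD x j : G x -> `|x - pts j| <= 2 * B.
  move=> Gx; apply: le_trans (ler_normB _ _) _.
  by have := GB _ Gx; have := GB _ (Gpts j); lra.
have [d d0 Fd] := Fu M M0.
have [k k0 Qk] := Qfar d d0.
have [L L0 QL] := Qt _ D0.
pose a := (2 * (L + 1))^-1.
have L2 : 0 < 2 * (L + 1) by lra.
have a0 : 0 < a by rewrite invr_gt0.
pose Q' x := a * Q x.
have Q'1 u : `|u| <= 2 * B -> Q' u <= 1 / 2.
  move=> /QL [Qu _]; rewrite /Q' /a mulrC ler_pdivrMr//.
  by have := ler_norm (Q u); lra.
pose N := (Num.trunc (62 / (a * k))).+1.
have ak0 : 0 < a * k by exact: mulr_gt0.
have far u : d <= `|u| -> 62 / N%:R <= Q' u.
  move=> /Qk ku; apply: (@le_trans _ _ (a * k)); last by rewrite ler_wpM2l// ltW.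
  rewrite ler_pdivrMr ?ltr0n// mulrC -ler_pdivrMr//.
  by rewrite ltW// truncnS_gt.
have [H [Ha Hl H01 Hlo Hhi]] := @analytic_separation R X G Q' (2 * B) pts
  (fun j => 0 < F (pts j)) N D0 GD (tame_mul (tame_cst a) Qt)
  (etrans (congr1 _ Q00) (mulr0 a)) (fun u => mulr_ge0 (ltW a0) (Q0 u))
  Q'1 (ltn0Sn _) ptsG.
exists H; split=> // x Gx Fx.
- apply: Hlo => // j Fj; apply: far; rewrite leNgt; apply/negP => xj.
  by have := Fd x (pts j) Gx (Gpts j) xj; rewrite ltr_norml; lra.
- apply: Hhi => // j; rewrite -leNgt => Fj; apply: far; rewrite leNgt; apply/negP => xj.
  by have := Fd x (pts j) Gx (Gpts j) xj; rewrite ltr_norml; lra.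
Qed.

Lemma unif_continuous_uniform_on (R : realType) (X : normedModType R) (G : set X)
  (F : X -> R) : unif_continuous (F : subspace G -> R) -> uniform_on G F.
Proof.
move=> Fu e e0.
have Re : entourage [set xy : R * R | `|xy.1 - xy.2| < e].
  by rewrite -entourage_ballE; exists e => // xy; rewrite -ball_normE.
have [E + EF] := Fu _ Re.
rewrite -entourage_ballE => -[d d0 dE]; exists d => // x y Gx Gy xyd.
by apply: (EF (x, y)); right; do 2 split => //; apply: dE; rewrite -ball_normE.
Qed.

Lemma lipschitz_bound_lipschitz (R : realType) (X : normedModType R) (G : set X)
  (K : X -> R) : lipschitz_bound_on G K -> [lipschitz (K x : R^o) | x in G].
Proof.
move=> [L L0 KL]; exists L; split; first exact: ger0_real.
move=> M LM [x y] [/= Gx Gy]; apply: le_trans (KL x y Gx Gy) _.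
by rewrite ler_wpM2r// ltW.
Qed.

Unset Implicit Arguments.

Theorem theorem1 (R : realType) (X : completeNormedModType R)
    (hsep : separable_space X)
    (hpoly : exists q : X -> R, separating_polynomial q)
    (G : set X) (Gopen : open G) (Gbounded : bounded_set G)
    (F : X -> R)
    (Fbounded : [bounded F x | x in G])
    (Funif : unif_continuous (F : subspace G -> R))
    (eps : R) (eps_gt0 : 0 < eps) :
  exists K : X -> R,
    [/\ real_analytic_on G K,
        [lipschitz (K x : R^o) | x in G]
      & forall x, G x -> `|F x - K x| < eps].
Proof.
have [->|/set0P G0] := eqVneq G set0.
  by exists (fun=> 0); split=> [x []||x []]; exact: lipschitz_set0.
have [M M0 FM] : exists2 M : R, 0 < M & forall x, G x -> `|F x| <= M.
  by have /pinfty_ex_gt0 [M M0 FM] := Fbounded; exists M.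
have Gsep := separating_uniform_levels hsep hpoly Gopen Gbounded G0.
have [n nM] : exists n, (3 / 4) ^+ n * M < eps.
  have : geometric M (3 / 4) @ \oo --> (0 : R).
    by apply: cvg_geometric; rewrite ger0_norm; lra.
  move=> /cvgr0_norm_lt /(_ _ eps_gt0) [n _ /(_ n (leqnn n))].
  by exists n; rewrite mulrC (le_lt_trans (ler_norm _)).
have [K [Ka Kl KF]] := tietze_iteration Gsep n M0 (unif_continuous_uniform_on Funif) FM.
exists K; split; first exact: power_series_analytic.
  exact: lipschitz_bound_lipschitz.
by move=> x Gx; exact: le_lt_trans (KF x Gx) nM.
Qed.
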